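(* Let $K$ be a field of characteristic $2$. (i) Let $F|K=K(x,y)|K$ and $F'|K=K(x',y')|K$ be two function fields of type (i) (see context), with constants $a_0,a_2,a_4$ and $a_0',a_2',a_4'$ respectively. Then the $K$-isomorphisms $F'\overset\sim\to F$ are given by the transformations $$(x',y') \mapsto ( \varepsilon^4 ( x + \alpha ), \varepsilon (y + \gamma x + \beta) ),$$ where $\varepsilon,\alpha,\beta,\gamma \in K$ are constants such that $\varepsilon\neq 0$, $\varepsilon^{4} a_2' = a_2$, $\varepsilon^{12} a_4' = a_4 + \gamma^4$, $\varepsilon^{-4} a_0' = a_0 + \alpha^2 a_2 + \alpha^4 a_4 + \beta^4 + \gamma^4 \alpha^4 + \alpha$. The automorphisms of $F|K$ are given by $$(x,y) \mapsto ( \varepsilon ( x + \alpha ), \varepsilon (y + \beta) ),$$ where $\varepsilon,\alpha,\beta \in K$ satisfy $\varepsilon^3 = 1$, $(\varepsilon + 1) a_2 = 0$, $\beta^4 = (\varepsilon^{2} + 1) a_0 + \alpha^2 a_2 + \alpha^4 a_4 + \alpha$. (ii) Let $F|K=K(x,z,y)|K$ and $F'|K=K(x',z',y')|K$ be two function fields of type (ii) (see context), with constants $a_0,a_2,c_0,c_1,c_2$ and $a_0',a_2',c_0',c_1',c_2'$ respectively. Then the $K$-isomorphisms $F'\overset\sim\to F$ are given by the transformations $$(x',z',y') \mapsto ( \varepsilon^8 ( x + \alpha ), \varepsilon^2 (z + \beta), \varepsilon (y + \tau + \gamma z) ),$$ where $\varepsilon,\alpha,\beta,\tau,\gamma \in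 K$ are constants such that $\varepsilon\neq 0$, $\varepsilon^8 a_2' = a_2$, $\varepsilon^6 c_1' = c_1$, $\varepsilon^2 c_2' = c_2 + \gamma^2$, $\varepsilon^{-8} a_0' = a_0 + \alpha^2 a_2 + \alpha + \beta^4$, $\varepsilon^{-2} c_0' = c_0 + \alpha c_1 + \beta^2 (c_2 + \gamma^2) + \beta + \tau^2$. In particular the quotient $\iota = c_1^4/a_2^3$ is an invariant of the function field $F|K$. The automorphisms of $F|K$ are given by $$(x,z,y) \mapsto (x + \alpha, z + \beta, y + \tau),$$ where $\alpha,\beta,\tau \in K$ satisfy $\beta^4 = \alpha + \alpha^2 a_2$, $\tau^2 = \alpha c_1 + \beta + \beta^2 c_2$.
   Context: $K^2=\{t^2:t\in K\}$. A function field of type (i) is $F|K=K(x,y)|K$, of transcendence degree $1$, where $y^4 = a_0 + x + a_2 x^2 + a_4 x^4$ and $a_0,a_2,a_4\in K$ with $a_4\notin K^2$. A function field of type (ii) is $F|K = K(x,z,y)|K$, of transcendence degree $1$, where $z^4 = a_0 + x + a_2 x^2$, $y^2 = c_0 + c_1 x + z + c_2 z^2$, and $a_0,a_2,c_0,c_1,c_2 \in K$ are constants satisfying $a_2\notin K^2$ and ($c_1\neq 0$ or $c_2\notin K^2 + K^2 a_2$). The primed function fields are given by the same equations with all variables and constants primed. Isomorphisms and automorphisms are $K$-isomorphisms of fields; ''invariant'' means depending only on the $K$-isomorphism class. *)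

(* Defs.v *)
From HB Require Import structures.
From mathcomp Require Export all_boot all_order all_algebra.

Set Implicit Arguments.
Unset Strict Implicit.
Unset Printing Implicit Defensive.

Import GRing.Theory.
Local Open Scope ring_scope.

(* A field extension F|K is given by an embedding i : {rmorphism K -> F};
   MathComp's fieldExtType only covers extensions of finite degree. *)

(* u lies in the subfield K(s) of F; divring_closed predicates on a field are
   exactly its subfields. *)
Definition in_adjoin (K F : fieldType) (i : {rmorphism K -> F}) (s : seq F)
    (u : F) : Prop :=
  forall S : {pred F},
    GRing.divring_closed S -> (forall a, i a \in S) -> {subset s <= S} ->
    u \in S.

Definition generated_by (K F : fieldType) (i : {rmorphism K -> F})
    (s : seq F) : Prop :=
  forall u : F, in_adjoin i s u.

Definition algebraic_over_adjoin (K F : fieldType) (i : {rmorphism K -> F})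
    (s : seq F) (u : F) : Prop :=
  exists p : {poly F},
    [/\ p != 0, (forall n, in_adjoin i s p`_n) & root p u].

(* F|K has a transcendence basis consisting of one element. *)
Definition trdeg1 (K F : fieldType) (i : {rmorphism K -> F}) : Prop :=
  exists t : F,
    ~ algebraicOver i t /\ forall u : F, algebraic_over_adjoin i [:: t] u.

Definition type_i (K F : fieldType) (i : {rmorphism K -> F})
    (a0 a2 a4 : K) (x y : F) : Prop :=
  [/\ generated_by i [:: x; y],
      trdeg1 i,
      y ^+ 4 = i a0 + x + i a2 * x ^+ 2 + i a4 * x ^+ 4
    & ~ exists t : K, a4 = t ^+ 2].

Definition type_ii (K F : fieldType) (i : {rmorphism K -> F})
    (a0 a2 c0 c1 c2 : K) (x z y : F) : Prop :=
  [/\ generated_by i [:: x; z; y] /\ trdeg1 i,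
      z ^+ 4 = i a0 + x + i a2 * x ^+ 2,
      y ^+ 2 = i c0 + i c1 * x + z + i c2 * z ^+ 2,
      ~ exists t : K, a2 = t ^+ 2
    & c1 <> 0 \/ ~ exists s t : K, c2 = s ^+ 2 + t ^+ 2 * a2].

Definition K_isom (K F' F : fieldType) (i' : {rmorphism K -> F'})
    (i : {rmorphism K -> F}) (phi : {rmorphism F' -> F}) : Prop :=
  bijective phi /\ forall a : K, phi (i' a) = i a.

(* The K-isomorphisms F' -> F are given by the transformations g |-> h of the
   generators g of F'|K, where h ranges over T. *)
Definition K_isoms_given_by (K F' F : fieldType) (i' : {rmorphism K -> F'})
    (i : {rmorphism K -> F}) (g : seq F') (T : seq F -> Prop) : Prop :=
  (forall phi : {rmorphism F' -> F}, K_isom i' i phi -> T (map phi g)) /\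
  (forall h : seq F, T h ->
     exists phi : {rmorphism F' -> F},
       [/\ K_isom i' i phi, map phi g = h
         & forall psi : {rmorphism F' -> F},
             K_isom i' i psi -> map psi g = h -> psi =1 phi]).

(* Main.v *)
Require Import Defs.
From HB Require Import structures.
From mathcomp Require Import all_boot all_order all_algebra.
From mathcomp Require Import ring boolp.
Import GRing.Theory.
Local Open Scope ring_scope.

Set Implicit Arguments.
Unset Strict Implicit.
Unset Printing Implicit Defensive.

(** Put q = a0 + x + a2 x^2 + a4 x^4, so that y^4 = q in type (i) and, with
    a4 = 0, z^4 = q in type (ii).  The proof takes place over K(x) and uses two
    facts.

    The subfield K(x) is intrinsic.  With n = 2 in type (i) and n = 3 in
    type (ii), every 2^n-th power of an element of F lies in K(x), and x is a
    polynomial over K in 2^n-th powers; hence K(x) is the compositum of K and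
    F^(2^n).  An isomorphism F' -> F therefore maps K(x') onto K(x), so it sends
    x' to a fractional linear transform of x ([isom_ratfun], [moebius]).

    In characteristic 2 squares have derivative 0, whereas q has derivative 1.
    So if f, g in K(x) and f^2 + g^2 q = S is a polynomial, then g^2 = S' and
    f^2 = S + S' q: since K[x] is integrally closed, f and g are polynomials
    with known squares ([ratfun_sqr_split]).  As F is built from K(x) by
    adjoining square roots, the equation satisfied by the image of a generator
    unfolds into a chain of equations of this shape.  The coefficient of
    x^(2k) in h^2 is the square of that of x^k in h, so each coefficient that
    ought to vanish would otherwise exhibit a4 (type (i)) or a2 (type (ii)) as
    a square in K.  This leaves exactly the announced transformations
    ([quartic_transform], [type_ii_y_transform]).

    Conversely, the announced formulas define generators X, Y (or X, Z, Y) of F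
    that satisfy the primed equations ([type_i_change], [type_ii_change]).  The
    isomorphism pairs u' in F' with the u in F for which u'^(2^n) and u^(2^n)
    are the same rational function, of x' and of X respectively.  This pairing
    is compatible with the field operations because u |-> u^(2^n) is an
    injective ring morphism ([same_power_isom]).  The automorphisms are the case
    of equal constants.  *)

(** * Identities in characteristic two *)

Lemma even_numerals (R : comPzRingType) : 2%:R = 0 :> R ->
  [/\ (2%:R = 0 :> R) /\ (- 2%:R = 0 :> R),
      (4%:R = 0 :> R) /\ (- 4%:R = 0 :> R),
      (6%:R = 0 :> R) /\ (- 6%:R = 0 :> R)
    & (8%:R = 0 :> R) /\ (- 8%:R = 0 :> R)].
Proof.
move=> two0; have E n : (2 * n)%:R = 0 :> R by rewrite natrM two0 mul0r.
by rewrite two0 oppr0 (E 2) (E 3) (E 4) oppr0.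
Qed.

(** The ring decision procedure only cancels a numeral that is literally
    rewritten to 0, so the identity is first turned into [lhs - rhs = 0], where
    all coefficients are even; those up to 8 in absolute value are enough for
    the identities below. *)
Ltac ring2 two0 :=
  let h2 := fresh in let g2 := fresh in let h4 := fresh in let g4 := fresh in
  let h6 := fresh in let g6 := fresh in let h8 := fresh in let g8 := fresh in
  apply: subr0_eq;
  have [[h2 g2] [h4 g4] [h6 g6] [h8 g8]] := even_numerals two0;
  ring: h2 g2 h4 g4 h6 g6 h8 g8.

Ltac field2 two0 :=
  let h2 := fresh in let g2 := fresh in let h4 := fresh in let g4 := fresh in
  let h6 := fresh in let g6 := fresh in let h8 := fresh in let g8 := fresh in
  apply: subr0_eq;
  have [[h2 g2] [h4 g4] [h6 g6] [h8 g8]] := even_numerals two0;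
  field: h2 g2 h4 g4 h6 g6 h8 g8.

(** Characteristic 2 is carried around as the equation 2 = 0, which is what the
    tactics above consume. *)
Lemma two0_rmorph (K : fieldType) (R : pzRingType) (i : {rmorphism K -> R}) :
  2%:R = 0 :> K -> 2%:R = 0 :> R.
Proof. by move=> two0; rewrite -(rmorph_nat i) two0 rmorph0. Qed.

Lemma sqrD2 (R : comPzRingType) (a b : R) :
  2%:R = 0 :> R -> (a + b) ^+ 2 = a ^+ 2 + b ^+ 2.
Proof. by move=> two0; ring2 two0. Qed.

Lemma exprB2n (R : comPzRingType) n (a b : R) :
  2%:R = 0 :> R -> (a - b) ^+ (2 ^ n) = a ^+ (2 ^ n) - b ^+ (2 ^ n).
Proof.
move=> two0; elim: n => [|n IHn]; first by rewrite !expr1.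
by rewrite expnS mulnC !exprM IHn; ring2 two0.
Qed.

Lemma expf2n_inj (R : idomainType) n (a b : R) :
  2%:R = 0 :> R -> a ^+ (2 ^ n) = b ^+ (2 ^ n) -> a = b.
Proof.
move=> two0 e; have /eqP : (a - b) ^+ (2 ^ n) = 0 by rewrite exprB2n // e subrr.
by rewrite expf_eq0 => /andP[_ /eqP/subr0_eq].
Qed.

Lemma coef_sqr2 (R : comNzRingType) (h : {poly R}) k :
  2%:R = 0 :> R -> (h ^+ 2)`_(k.*2) = h`_k ^+ 2.
Proof.
move=> two0; have two0P : 2%:R = 0 :> {poly R} by rewrite -polyC_natr two0.
elim/poly_ind: h k => [|p c IHp] k; first by rewrite expr0n !coef0 expr0n.
have -> : (p * 'X + c%:P) ^+ 2 = p ^+ 2 * 'X^2 + (c ^+ 2)%:P.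
  by rewrite sqrD2 // exprMn polyC_exp.
rewrite !coefD coefMXn coefMX !coefC; case: k => [|k] /=; first by rewrite !add0r.
by rewrite !addr0 doubleS /= !subSS subn0 IHp.
Qed.

Lemma size_sqr_le (R : idomainType) (h : {poly R}) n :
  (size (h ^+ 2)%R <= (n.*2).+1)%N -> (size h <= n.+1)%N.
Proof.
move=> le_h2; have := size_exp h 2; rewrite muln2 => e.
have: ((size h).-1.*2 <= n.*2)%N by rewrite -e; case: size le_h2.
by rewrite leq_double; case: size.
Qed.

Lemma sqr_polyC (R : idomainType) (h : {poly R}) c :
  h ^+ 2 = c%:P -> exists2 t, h = t%:P & t ^+ 2 = c.
Proof.
move=> h2; have /size1_polyC e : (size h <= 1)%N.
  by apply: (@size_sqr_le _ _ 0); rewrite h2 size_polyC; case: eqP.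
by exists h`_0 => //; apply: polyC_inj; rewrite -h2 polyC_exp -e.
Qed.

Lemma poly3 (R : nzRingType) (h : {poly R}) : (size h <= 3)%N ->
  h = (h`_0)%:P + (h`_1)%:P * 'X + (h`_2)%:P * 'X^2.
Proof.
move=> le_h; apply/polyP=> k; rewrite !coefD !coefCM coefC coefX coefXn.
case: k => [|[|[|k]]]; rewrite ?mulr0 ?mulr1 ?addr0 ?add0r //=.
by rewrite nth_default // (leq_trans le_h).
Qed.

Lemma deriv_sqr2 (R : comNzRingType) (p : {poly R}) :
  2%:R = 0 :> R -> (p ^+ 2)^`() = 0.
Proof. by move=> two0; rewrite deriv_exp -mulr_natr -polyC_natr two0 mulr0. Qed.

(** * Subfields *)

Section Subfields.
Variable F : fieldType.
Implicit Types (P : F -> Prop) (u v w : F).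

(** The propositional counterpart of [divring_closed]: the subfields needed here
    are given by existential statements. *)
Definition subfield P :=
  [/\ P 1, forall u v, P u -> P v -> P (u - v)
    & forall u v, P u -> P v -> P (u / v)].

Lemma subfield0 P : subfield P -> P 0.
Proof. by case=> P1 PB _; rewrite -(subrr 1); apply: PB. Qed.

Lemma subfieldB P u v : subfield P -> P u -> P v -> P (u - v).
Proof. by case=> _ PB _; apply: PB. Qed.

Lemma subfield_div P u v : subfield P -> P u -> P v -> P (u / v).
Proof. by case=> _ _ PV; apply: PV. Qed.

Lemma subfieldN P u : subfield P -> P u -> P (- u).
Proof. by move=> sP Pu; rewrite -sub0r; apply: subfieldB => //; apply: subfield0. Qed.

Lemma subfieldD P u v : subfield P -> P u -> P v -> P (u + v).
Proof. by move=> sP Pu Pv; rewrite -[v]opprK; apply: subfieldB => //; apply: subfieldN. Qed.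

Lemma subfieldM P u v : subfield P -> P u -> P v -> P (u * v).
Proof. by move=> sP Pu Pv; rewrite -[v]invrK -[v^-1]mul1r; do 2!apply: subfield_div => //; case: sP. Qed.

Lemma subfieldX P u n : subfield P -> P u -> P (u ^+ n).
Proof.
move=> sP Pu; elim: n => [|n IHn]; first by rewrite expr0; case: sP.
by rewrite exprS; apply: subfieldM.
Qed.

(** [in_adjoin] quantifies over boolean predicates; classical truth values turn a
    propositional P into one. *)
Lemma generated_ind (K : fieldType) (i : {rmorphism K -> F}) s P :
  generated_by i s -> subfield P -> (forall a, P (i a)) ->
  (forall u, u \in s -> P u) -> forall u, P u.
Proof.
move=> gen [P1 PB PV] PK Ps u.
have := gen u [pred v | `[< P v >]]; rewrite inE => /(_ _ _ _)/asboolP; apply.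
- split=> [|v w|v w]; rewrite ?inE; first exact/asboolP.
    by move=> /asboolP Pv /asboolP Pw; apply/asboolP/PB.
  by move=> /asboolP Pv /asboolP Pw; apply/asboolP/PV.
- by move=> a; rewrite inE; apply/asboolP.
- by move=> v /Ps Pv; rewrite inE; apply/asboolP.
Qed.

(** Raising to the power 2^n is a ring morphism. *)
Lemma subfield_power P n : 2%:R = 0 :> F ->
  subfield P -> subfield (fun u => P (u ^+ (2 ^ n))).
Proof.
move=> two0 [P1 PB PV]; split=> [|u v Pu Pv|u v Pu Pv]; first by rewrite expr1n.
  by rewrite exprB2n //; apply: PB.
by rewrite expr_div_n; apply: PV.
Qed.

Definition adjoin_sqrt P w u := exists a b, [/\ P a, P b & u = a + b * w].

Lemma adjoin_sqrt_base P w u : subfield P -> P u -> adjoin_sqrt P w u.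
Proof. by move=> sP Pu; exists u, 0; split; rewrite ?mul0r ?addr0 //; apply: subfield0. Qed.

Lemma adjoin_sqrt_gen P w : subfield P -> adjoin_sqrt P w w.
Proof. by move=> sP; exists 0, 1; split; rewrite ?mul1r ?add0r //; [apply: subfield0 | case: sP]. Qed.

(** In characteristic 2 the element c + d w has its square c^2 + d^2 w^2 in P,
    whence the inverse (c + d w) / (c^2 + d^2 w^2). *)
Lemma subfield_adjoin_sqrt P w : 2%:R = 0 :> F ->
  subfield P -> P (w ^+ 2) -> subfield (adjoin_sqrt P w).
Proof.
move=> two0 sP Pw; have [P1 PB PV] := sP.
split=> [|_ _ [a [b [Pa Pb ->]]] [c [d [Pc Pd ->]]]|
           _ _ [a [b [Pa Pb ->]]] [c [d [Pc Pd ->]]]].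
- exact: adjoin_sqrt_base.
- by exists (a - c), (b - d); split; [apply: PB | apply: PB | ring].
have [n0 | n_neq0] := eqVneq (c + d * w) 0.
  by rewrite n0 invr0 mulr0; apply: adjoin_sqrt_base => //; apply: subfield0.
pose m := c ^+ 2 + d ^+ 2 * w ^+ 2.
have def_m : m = (c + d * w) ^+ 2 by rewrite sqrD2 // exprMn.
exists ((a * c + b * d * w ^+ 2) / m), ((a * d + b * c) / m); split.
- by apply: (PV); apply: subfieldD => //; do ?apply: subfieldM => //; do ?apply: subfieldM => //; apply: subfieldX.
- by apply: (PV); apply: subfieldD => //; do ?apply: subfieldM => //; do ?apply: subfieldM => //; apply: subfieldX.
by rewrite def_m; field2 two0.
Qed.

Lemma adjoin_sqrt_uniq P w a b c d : subfield P -> ~ P w ->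
  P a -> P b -> P c -> P d -> a + b * w = c + d * w -> a = c /\ b = d.
Proof.
move=> sP nPw Pa Pb Pc Pd e; have [_ PB PV] := sP.
have e' : (b - d) * w = c - a by rewrite -(addrK (b * w) a) e; ring.
have [/eqP bd|bd] := boolP (b - d == 0).
  by split; [apply/esym|]; apply: subr0_eq => //; rewrite -e' bd mul0r.
case: nPw; have -> : w = (c - a) / (b - d) by rewrite -e' mulrAC mulfV ?mul1r.
by apply: PV; apply: PB.
Qed.

End Subfields.

(** * The rational function field K(x) *)

Section RationalFunctions.
Variables (K F : fieldType) (i : {rmorphism K -> F}).
Implicit Types (p q d S h : {poly K}) (x u : F).

Definition ev x p : F := (map_poly i p).[x].

Lemma ev_is_zmod x : zmod_morphism (ev x).
Proof. by move=> p q; rewrite /ev rmorphB hornerD hornerN. Qed.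
Lemma ev_is_monoid x : monoid_morphism (ev x).
Proof. by split=> [|p q]; rewrite /ev ?rmorph1 ?hornerC // rmorphM hornerM. Qed.
HB.instance Definition _ x := GRing.isZmodMorphism.Build {poly K} F (ev x) (ev_is_zmod x).
HB.instance Definition _ x := GRing.isMonoidMorphism.Build {poly K} F (ev x) (ev_is_monoid x).

Lemma evC x a : ev x a%:P = i a.
Proof. by rewrite /ev map_polyC hornerC. Qed.
Lemma evX x : ev x 'X = x.
Proof. by rewrite /ev map_polyX hornerX. Qed.

Definition ratfun x u := exists p d, ev x d != 0 /\ u = ev x p / ev x d.

Lemma ratfun_ev x p : ratfun x (ev x p).
Proof. by exists p, 1; rewrite rmorph1 oner_neq0 divr1. Qed.
Lemma ratfun_const x a : ratfun x (i a).
Proof. by rewrite -(evC x); apply: ratfun_ev. Qed.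
Lemma ratfun_x x : ratfun x x.
Proof. by rewrite -{2}(evX x); apply: ratfun_ev. Qed.

Lemma subfield_ratfun x : subfield (ratfun x).
Proof.
split=> [|_ _ [p [d [d0 ->]]] [q [e [e0 ->]]]|_ _ [p [d [d0 ->]]] [q [e [e0 ->]]]].
- by rewrite -(rmorph1 (ev x)); apply: ratfun_ev.
- exists (p * e - q * d), (d * e); rewrite rmorphB !rmorphM mulf_neq0 //.
  by split=> //; field; rewrite /= e0 d0.
have [q0|q0] := eqVneq (ev x q) 0.
  by rewrite q0 mul0r invr0 mulr0 -(rmorph0 (ev x)); apply: ratfun_ev.
by exists (p * e), (d * q); rewrite !rmorphM mulf_neq0 //; split=> //; field; rewrite /= ?q0 ?e0 ?d0.
Qed.

Section Transcendental.
Variable x : F.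
Hypothesis x_tr : ~ algebraicOver i x.

Lemma ev_eq0 p : ev x p = 0 -> p = 0.
Proof.
move=> p0; apply/eqP; apply: contraT => p_neq0; case: x_tr.
by exists p => //; apply/rootP.
Qed.

Lemma ev_inj p q : ev x p = ev x q -> p = q.
Proof. by move=> e; apply: subr0_eq; apply: ev_eq0; rewrite rmorphB /= e subrr. Qed.

(** K[x] is integrally closed in K(x). *)
Lemma ratfun_sqrt u S : ratfun x u -> u ^+ 2 = ev x S ->
  exists2 h, u = ev x h & h ^+ 2 = S.
Proof.
case=> p [d [d0 ->]] e.
have d_neq0 : d != 0 by apply: contraNneq d0 => ->; rewrite rmorph0.
have e2 : p ^+ 2 = S * d ^+ 2.
  by apply: ev_inj; rewrite rmorphXn rmorphM rmorphXn /= -e; field.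
have /dvdpP[h def_p] : (d %| p)%R by rewrite -(@dvdp_pexp2r _ _ _ 2) // e2 dvdp_mull.
exists h; first by rewrite def_p rmorphM mulfK.
by apply: (mulIf (expf_neq0 2 d_neq0)); rewrite -exprMn -def_p.
Qed.

Hypothesis two0 : 2%:R = 0 :> K.

(** After clearing denominators, differentiation kills both squares and leaves
    g^2 = S' because q' = 1; then f^2 = S + S' q as well. *)
Lemma ratfun_sqr_split f g q S : ratfun x f -> ratfun x g -> q^`() = 1 ->
  f ^+ 2 + g ^+ 2 * ev x q = ev x S ->
  exists k h, [/\ f = ev x k, g = ev x h, h ^+ 2 = S^`() & k ^+ 2 = S + h ^+ 2 * q].
Proof.
move=> Rf Rg dq e; have two0F := two0_rmorph i two0.
have two0P := two0_rmorph (@polyC K) two0.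
case: (Rf) => p [d [d0 def_f]]; case: (Rg) => r [c [c0 def_g]].
have e2 : (p * c) ^+ 2 + (r * d) ^+ 2 * q = S * (c * d) ^+ 2.
  by apply: ev_inj; rewrite !(rmorphD, rmorphXn, rmorphM) /= -e def_f def_g; field; rewrite c0.
have := congr1 (@deriv _) e2; rewrite derivD deriv_sqr2 // derivM deriv_sqr2 // derivM deriv_sqr2 // dq.
rewrite !(mul0r, mulr0, add0r, addr0, mulr1) => e3.
have [h def_h h2] : exists2 h, g = ev x h & h ^+ 2 = S^`().
  apply: (ratfun_sqrt) => //; apply: (mulIf (expf_neq0 2 (mulf_neq0 c0 d0))).
  by rewrite -!rmorphM -rmorphXn -rmorphM /= -e3 def_g !(rmorphXn, rmorphM) /=; field.
have [k def_k k2] : exists2 k, f = ev x k & k ^+ 2 = S + h ^+ 2 * q.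
  apply: ratfun_sqrt => //; rewrite rmorphD rmorphM rmorphXn /= -def_h -e.
  by ring2 two0F.
by exists k, h.
Qed.

End Transcendental.
End RationalFunctions.

(** * Generators of K(x) *)

Section Moebius.
Variables (K F : fieldType) (i : {rmorphism K -> F}).
Implicit Types (N D P : {poly K}) (x X : F).

(** The form of degree n attached to P, evaluated at (N, D). *)
Definition homogenize n N D P : {poly K} :=
  \sum_(k < n) P`_k *: (N ^+ k * D ^+ (n - k)).

Lemma ev_wide n x P : (size P <= n)%N -> ev i x P = \sum_(k < n) i P`_k * x ^+ k.
Proof.
move=> le_n; rewrite /ev (@horner_coef_wide _ n) ?size_map_poly //.
by apply: eq_bigr => k _; rewrite coef_map.
Qed.

Lemma map_homogenize n N D P :
  map_poly i (homogenize n N D P) =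
  \sum_(k < n) i P`_k *: (map_poly i N ^+ k * map_poly i D ^+ (n - k)).
Proof.
by rewrite rmorph_sum; apply: eq_bigr => k _; rewrite /= map_polyZ rmorphM !rmorphXn.
Qed.

Lemma ev_homogenize n N D P x : (size P <= n)%N -> ev i x D != 0 ->
  ev i x (homogenize n N D P) = ev i x D ^+ n * ev i (ev i x N / ev i x D) P.
Proof.
move=> le_n D0; rewrite {1}/ev map_homogenize horner_sum (ev_wide _ le_n) mulr_sumr.
apply: eq_bigr => k _; rewrite hornerZ hornerM !horner_exp -!/(ev i x _).
have -> : ev i x D ^+ n = ev i x D ^+ (n - k) * ev i x D ^+ k.
  by rewrite -exprD subnK // ltnW.
rewrite expr_div_n; field.
by rewrite expf_neq0.
Qed.

(** Modulo N(T) - X D(T) one has N = X D, hence N^k D^(n-k) = X^k D^n. *)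
Lemma dvdp_homogenize n N D P X : (size P <= n)%N ->
  map_poly i N - X%:P * map_poly i D %|
  (ev i X P)%:P * map_poly i D ^+ n - map_poly i (homogenize n N D P).
Proof.
move=> le_n; rewrite map_homogenize (ev_wide _ le_n) rmorph_sum mulr_suml -sumrB.
apply: (big_ind (fun p => _ %| p)) => [|p q p0 q0|k _]; [exact: dvdp0 | exact: dvdp_add | ].
rewrite rmorphM rmorphXn /= -mul_polyC.
set T := map_poly i N; set U := map_poly i D.
have -> : U ^+ n = U ^+ (n - k) * U ^+ k by rewrite -exprD subnK // ltnW.
have -> : (i P`_k)%:P * X%:P ^+ k * (U ^+ (n - k) * U ^+ k)
           - (i P`_k)%:P * (T ^+ k * U ^+ (n - k))
         = - ((i P`_k)%:P * U ^+ (n - k) * (T ^+ k - (X%:P * U) ^+ k)).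
  by rewrite exprMn; ring.
by rewrite dvdpNr dvdp_mull // subrXX dvdp_mulr.
Qed.

(** Let X = N(x)/D(x) in lowest terms and x = A(X)/B(X).  The polynomial
    M = N(T) - X D(T) has T = x as its only root: homogenizing the identity
    A(N/D) = T B(N/D) and reducing it modulo M shows that M divides
    D(T)^n B(X) (T - x), and M is prime to D.  So M, and with it N and D, has
    degree at most 1. *)
Lemma moebius x X : ~ algebraicOver i x -> ratfun i x X -> ratfun i X x ->
  exists a b c d : K, [/\ a * d - b * c != 0, i c * x + i d != 0
    & X = (i a * x + i b) / (i c * x + i d)].
Proof.
move=> x_tr [N0 [D0 [D00 defX0]]] [A [B [B0 defx]]].
have D0_neq0 : D0 != 0 by apply: contraNneq D00 => ->; rewrite rmorph0.
have [N [D [co_ND Dx0 defX]]] : exists N D, [/\ coprimep N D, ev i x D != 0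
    & X = ev i x N / ev i x D].
  have g0 : gcdp N0 D0 != 0 by rewrite gcdp_eq0 negb_and D0_neq0 orbT.
  have eN : ev i x N0 = ev i x (N0 %/ gcdp N0 D0) * ev i x (gcdp N0 D0).
    by rewrite -rmorphM divpK // dvdp_gcdl.
  have eD : ev i x D0 = ev i x (D0 %/ gcdp N0 D0) * ev i x (gcdp N0 D0).
    by rewrite -rmorphM divpK // dvdp_gcdr.
  exists (N0 %/ gcdp N0 D0), (D0 %/ gcdp N0 D0).
  rewrite coprimep_div_gcd ?D0_neq0 ?orbT //.
  move: D00; rewrite eD mulf_eq0 negb_or => /andP[u0 v0]; split=> //.
  by rewrite defX0 eN eD; field; rewrite u0 v0.
have nX c : X <> i c.
  move=> eX; apply: x_tr; rewrite defx eX; apply: algebraic_div.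
  - by exists ('X - (A.[c])%:P); rewrite ?polyXsubC_eq0 // rmorphB /= map_polyX map_polyC /= root_XsubC /ev horner_map.
  - by exists ('X - (B.[c])%:P); rewrite ?polyXsubC_eq0 // rmorphB /= map_polyX map_polyC /= root_XsubC /ev horner_map.
pose M := map_poly i N - X%:P * map_poly i D.
pose n := maxn (size A) (size B).
have AxB : ev i X A = x * ev i X B by rewrite [X in X * _]defx; field.
have homAB : homogenize n N D A = 'X * homogenize n N D B.
  apply: (ev_inj x_tr); rewrite rmorphM /= evX.
  rewrite !ev_homogenize ?leq_maxl ?leq_maxr // -defX.
  by rewrite AxB; ring.
have dvdM : M %| map_poly i D ^+ n * ((ev i X B)%:P * ('X - x%:P)).
  have dA := dvdp_homogenize N D X (leq_maxl _ _).
  have dB := dvdp_homogenize N D X (leq_maxr _ _).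
  have -> : map_poly i D ^+ n * ((ev i X B)%:P * ('X - x%:P)) =
    'X * ((ev i X B)%:P * map_poly i D ^+ n - map_poly i (homogenize n N D B))
    - ((ev i X A)%:P * map_poly i D ^+ n - map_poly i (homogenize n N D A)).
    rewrite homAB rmorphM /= map_polyX.
    by rewrite AxB rmorphM /=; ring.
  by apply: dvdp_sub; [apply: dvdp_mull; exact: dB | exact: dA].
have size_M : (size M <= 2)%N.
  have coM : coprimep M (map_poly i D ^+ n).
    apply: coprimep_expr; rewrite coprimep_sym /M addrC -mulNr coprimep_addl_mul.
    by rewrite coprimep_map coprimep_sym.
  move: dvdM; rewrite Gauss_dvdpr // => /dvdp_leq.
  rewrite mulf_neq0 ?polyC_eq0 ?polyXsubC_eq0 // => /(_ isT) /leq_trans; apply.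
  by rewrite mul_polyC (leq_trans (size_scale_leq _ _)) // size_XsubC.
have ND0 k : (2 <= k)%N -> N`_k = 0 /\ D`_k = 0.
  move=> le2k; have: M`_k = 0 by rewrite nth_default // (leq_trans size_M).
  rewrite coefB coefCM !coef_map /= => /subr0_eq e.
  have [Dk|Dk] := eqVneq D`_k 0; last first.
    by case: (nX (N`_k / D`_k)); rewrite fmorph_div e mulfK // fmorph_eq0.
  by split=> //; apply/eqP; rewrite -(fmorph_eq0 i) e Dk rmorph0 mulr0.
have linear P : (forall k, (2 <= k)%N -> P`_k = 0) -> ev i x P = i P`_1 * x + i P`_0.
  move=> P0; rewrite (@ev_wide 2); first by rewrite !big_ord_recl big_ord0 /= addr0 mulr1 addrC.
  by apply/leq_sizeP.
have eN := linear N (fun k h => proj1 (ND0 k h)).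
have eD := linear D (fun k h => proj2 (ND0 k h)).
exists N`_1, N`_0, D`_1, D`_0; rewrite -eN -eD; split=> //.
apply/eqP=> /subr0_eq e.
have [D1|D1] := eqVneq D`_1 0; last first.
  apply: (nX (N`_1 / D`_1)); rewrite defX; apply: (canLR (mulfK _)) => //.
  rewrite eN eD fmorph_div; have iD1 : i D`_1 != 0 by rewrite fmorph_eq0.
  have := congr1 i e; rewrite !rmorphM => e'.
  by apply: (mulIf iD1); rewrite mulrDl -e'; field.
move: Dx0 e; rewrite eD D1 rmorph0 mul0r add0r mulr0 fmorph_eq0 => D00' /eqP.
rewrite mulf_eq0 (negPf D00') orbF => /eqP N1.
apply: (nX (N`_0 / D`_0)).
by rewrite defX eN eD N1 D1 rmorph0 !mul0r !add0r fmorph_div.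
Qed.
End Moebius.

(** * The equation w^4 = a0 + x + a2 x^2 + a4 x^4 *)

Definition poly0124 (K : fieldType) (c0 c1 c2 c4 : K) : {poly K} :=
  c0%:P + c1%:P * 'X + c2%:P * 'X^2 + c4%:P * 'X^4.

Lemma ev_poly0124 (K F : fieldType) (i : {rmorphism K -> F}) x c0 c1 c2 c4 :
  ev i x (poly0124 c0 c1 c2 c4) = i c0 + i c1 * x + i c2 * x ^+ 2 + i c4 * x ^+ 4.
Proof. by rewrite !(rmorphD, rmorphXn, rmorphM) /= !evC evX. Qed.

Section Poly0124.
Variable K : fieldType.
Hypothesis two0 : 2%:R = 0 :> K.

Lemma deriv_poly0124 (c0 c1 c2 c4 : K) : (poly0124 c0 c1 c2 c4)^`() = c1%:P.
Proof.
have two0P := two0_rmorph (@polyC K) two0.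
rewrite /poly0124 !derivD derivC !deriv_mulC derivX !derivXn.
rewrite -(mulr_natr _ 2) -(mulr_natr _ 4) -[4%N]/(2 * 2)%N natrM two0P.
by rewrite !(mulr0, addr0, add0r) mulr1.
Qed.

Lemma sqr_poly0124 (h : {poly K}) (c0 c1 c2 c4 : K) :
  h ^+ 2 = poly0124 c0 c1 c2 c4 ->
  [/\ h = (h`_0)%:P + (h`_1)%:P * 'X + (h`_2)%:P * 'X^2,
      h`_0 ^+ 2 = c0, h`_1 ^+ 2 = c2 & h`_2 ^+ 2 = c4].
Proof.
move=> h2.
have coef k : (h ^+ 2)`_k = c0 *+ (k == 0) + c1 *+ (k == 1) + c2 *+ (k == 2) + c4 *+ (k == 4).
  rewrite h2 /poly0124 !coefD !coefCM coefC coefX !coefXn !mulr_natr.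
  by case: (k == 0).
have coef' k := coef_sqr2 h k two0; rewrite -(coef' 0) -(coef' 1) -(coef' 2) !coef /=.
rewrite !(mulr0n, mulr1n, addr0, add0r); split=> //; apply: poly3.
apply: (@size_sqr_le _ _ 2); apply/leq_sizeP => k lek; rewrite coef.
by case: k lek => [|[|[|[|[|k]]]]] //= _; rewrite !addr0.
Qed.
End Poly0124.

Section QuarticTransform.
Variables (K F : fieldType) (i : {rmorphism K -> F}).
Hypothesis two0 : 2%:R = 0 :> K.
Variables (x w : F) (a0 a2 a4 : K).
Hypotheses (x_tr : ~ algebraicOver i x).
Local Notation q := (poly0124 a0 1 a2 a4).
Local Notation R := (ratfun i x).
Hypothesis w4 : w ^+ 4 = ev i x q.

Let two0F : 2%:R = 0 :> F := two0_rmorph i two0.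
Let two0P : 2%:R = 0 :> {poly K} := two0_rmorph (@polyC K) two0.
Let sR : subfield R := subfield_ratfun i x.
Let dq : q^`() = 1 := deriv_poly0124 two0 a0 1 a2 a4.

(** The condition shared by type (i), where a4 is a nonsquare, and by the pair
    x, z of type (ii), where the quartic terms are absent. *)
Definition leading_nonsquare (b4 : K) :=
  (~ exists t, a4 = t ^+ 2) \/ [/\ a4 = 0, b4 = 0 & ~ exists t, a2 = t ^+ 2].

Lemma ratfun_constant_sqr u c : R u -> u ^+ 2 = i c -> exists2 t, u = i t & t ^+ 2 = c.
Proof.
move=> Ru; rewrite -(evC i x) => /(ratfun_sqrt x_tr Ru)[h -> /sqr_polyC[t -> t2]].
by exists t; rewrite ?evC.
Qed.

(** Here f1 + f3 w^2 stands for the w-component of a solution Y of the quartic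
    equation over X, and Y^2 = A + B w^2 with B = f1^2 + f3^2 q.  Multiplying
    the equation by D^4, where D = c x + d, makes the right side a polynomial
    with derivative (ad - bc) D^2; so D B is a constant t.  The same argument
    applied to t D = (D f1)^2 + (D f3)^2 q gives (D f3)^2 = t c, and if this
    were nonzero the square (D f1)^2 would exhibit a2 and a4 as squares.  Hence
    c = 0: the transform of x is affine. *)
Lemma denominator_constant (b0 b2 b4 a b c d : K) X f1 f3 A :
  leading_nonsquare b4 -> R f1 -> R f3 -> R A ->
  a * d - b * c != 0 -> i c * x + i d != 0 ->
  X = (i a * x + i b) / (i c * x + i d) ->
  A ^+ 2 + (f1 ^+ 2 + f3 ^+ 2 * ev i x q) ^+ 2 * ev i x q
    = i b0 + X + i b2 * X ^+ 2 + i b4 * X ^+ 4 ->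
  f3 = 0 /\ exists e alpha : K, [/\ e != 0, f1 = i e & X = i (e ^+ 4) * (x + i alpha)].
Proof.
move=> nsq Rf1 Rf3 RA del0 Dx0 defX eqX.
pose N := a%:P * 'X + b%:P; pose D := c%:P * 'X + d%:P.
have evN : ev i x N = i a * x + i b by rewrite rmorphD rmorphM /= !evC evX.
have evD : ev i x D = i c * x + i d by rewrite rmorphD rmorphM /= !evC evX.
rewrite -evD in Dx0; rewrite -evN -evD in defX; clear evN evD.
set B := f1 ^+ 2 + f3 ^+ 2 * ev i x q in eqX.
have RB : R B by apply: subfieldD => //; [|apply: subfieldM => //]; try (exact: subfieldX); exact: ratfun_ev.
have RD : R (ev i x D) by apply: ratfun_ev.
pose S := b0%:P * (D ^+ 2) ^+ 2 + N * D * D ^+ 2 + b2%:P * (N * D) ^+ 2 + b4%:P * (N ^+ 2) ^+ 2.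
have evS : ev i x S = i b0 * ev i x D ^+ 4 + ev i x N * ev i x D ^+ 3
    + i b2 * (ev i x N * ev i x D) ^+ 2 + i b4 * ev i x N ^+ 4.
  rewrite /S; move: (N) (D) => N' D'.
  by rewrite !(rmorphD, rmorphXn, rmorphM) /= !evC; ring.
have dS : S^`() = (a * d - b * c)%:P * D ^+ 2.
  rewrite /S !derivD !deriv_mulC !deriv_sqr2 // derivM deriv_sqr2 // derivM.
  have -> : N^`() = a%:P by rewrite derivD deriv_mulC derivX derivC addr0 mulr1.
  have -> : D^`() = c%:P by rewrite derivD deriv_mulC derivX derivC addr0 mulr1.
  by rewrite /D /N; ring2 two0P.
have [t DB t2] : exists2 t, ev i x D * B = i t & t ^+ 2 = a * d - b * c.
  have [] := @ratfun_sqr_split _ _ i x x_tr two0 (ev i x D ^+ 2 * A) (ev i x D ^+ 2 * B) q S.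
  - by apply: subfieldM => //; apply: subfieldX.
  - by apply: subfieldM => //; apply: subfieldX.
  - exact: dq.
  - transitivity (ev i x D ^+ 4 * (A ^+ 2 + B ^+ 2 * ev i x q)); first by ring.
    by rewrite evS eqX defX; field.
  move=> k [h [_ DDB h2 _]]; apply: ratfun_constant_sqr; first exact: subfieldM.
  apply: (mulIf (expf_neq0 2 Dx0)).
  rewrite -exprMn mulrAC -expr2 DDB -rmorphXn h2 dS.
  by rewrite rmorphM rmorphXn /= evC.
have t0 : t != 0 by apply: contraNneq del0 => t0; rewrite -t2 t0 expr0n.
have [k [h [Df1 Df3 h2 k2]]] : exists k h, [/\ ev i x D * f1 = ev i x k,
    ev i x D * f3 = ev i x h, h ^+ 2 = (t%:P * D)^`() & k ^+ 2 = t%:P * D + h ^+ 2 * q].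
  apply: ratfun_sqr_split => //; try exact: subfieldM.
  by rewrite rmorphM /= evC -DB /B; ring.
have [s defh s2] : exists2 s, h = s%:P & s ^+ 2 = t * c.
  apply: sqr_polyC; rewrite h2 deriv_mulC derivD deriv_mulC derivX derivC.
  by rewrite addr0 mulr1 polyCM.
have k2' : k ^+ 2 = poly0124 (t * d + s ^+ 2 * a0) (t * c + s ^+ 2) (s ^+ 2 * a2) (s ^+ 2 * a4).
  by rewrite k2 defh /poly0124 /D; ring.
have [_ _ k12 k22] := sqr_poly0124 two0 k2'.
have s0 : s = 0.
  apply/eqP; apply: contraT => s0; case: nsq => [ns4|[_ _ ns2]].
    by case: ns4; exists (k`_2 / s); rewrite expr_div_n k22; field.
  by case: ns2; exists (k`_1 / s); rewrite expr_div_n k12; field.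
have c0 : c = 0.
  by move/eqP: s2; rewrite s0 expr0n /= eq_sym mulf_eq0 (negPf t0) => /eqP.
have defD : D = d%:P by rewrite /D c0 mul0r add0r.
have d0 : d != 0 by move: Dx0; rewrite defD evC fmorph_eq0.
have a_neq0 : a != 0 by apply: contraNneq del0 => ->; rewrite c0 mul0r mulr0 subrr.
have [r defk r2] : exists2 r, k = r%:P & r ^+ 2 = t * d.
  by apply: sqr_polyC; rewrite k2' s0 c0 /poly0124; ring.
have id0 : i d != 0 by rewrite fmorph_eq0.
split.
  by apply/eqP; move/eqP: Df3; rewrite defh s0 rmorph0 mulf_eq0 (negPf Dx0).
have r0 : r != 0.
  by apply: contraNneq (mulf_neq0 t0 d0) => r0; rewrite -r2 r0 expr0n.
exists (r / d), (b / a); split.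
- by rewrite mulf_neq0 ?invr_eq0.
- by apply: (mulfI Dx0); rewrite Df1 defk defD !evC fmorph_div; field.
have -> : (r / d) ^+ 4 = a / d.
  rewrite expr_div_n -[4%N]/(2 * 2)%N !exprM r2 exprMn t2 c0; by field.
rewrite defX defD rmorphD rmorphM /= !evC evX !fmorph_div.
have ia0 : i a != 0 by rewrite fmorph_eq0.
by field; rewrite ia0.
Qed.

(** Write Y = (f0 + f2 w^2) + (f1 + f3 w^2) w.  Once f3 = 0 and f1 is a constant
    e, the component A = f0^2 + f2^2 q of Y^2 has a square of degree at most 4
    in x, so it is a polynomial s; splitting it in turn makes f2 a constant t,
    and t = 0 because otherwise f0^2 = s + t^2 q would make a4 or a2 a square.
    The relations between the constants are the coefficients of A^2. *)
Lemma quartic_transform (b0 b2 b4 : K) X Y :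
  leading_nonsquare b4 ->
  adjoin_sqrt (adjoin_sqrt R (w ^+ 2)) w Y -> R X -> ratfun i X x ->
  Y ^+ 4 = i b0 + X + i b2 * X ^+ 2 + i b4 * X ^+ 4 ->
  exists e alpha beta gamma : K, [/\ X = i (e ^+ 4) * (x + i alpha),
    Y = i e * (w + i gamma * x + i beta), e != 0,
    [/\ e ^+ 4 * b2 = a2 & e ^+ 12 * b4 = a4 + gamma ^+ 4]
    & e ^- 4 * b0 = a0 + alpha ^+ 2 * a2 + alpha ^+ 4 * a4
        + beta ^+ 4 + gamma ^+ 4 * alpha ^+ 4 + alpha].
Proof.
move=> nsq [A1 [B1 [[f0 [f2 [Rf0 Rf2 defA1]]] [f1 [f3 [Rf1 Rf3 defB1]]] defY]]] RX Xx eqX.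
have [a [b [c [d [del0 Dx0 defX]]]]] := moebius x_tr RX Xx.
set A := f0 ^+ 2 + f2 ^+ 2 * ev i x q.
have Rq : R (ev i x q) by apply: ratfun_ev.
have RA : R A by apply: subfieldD => //; [|apply: subfieldM => //]; exact: subfieldX.
have eqA : A ^+ 2 + (f1 ^+ 2 + f3 ^+ 2 * ev i x q) ^+ 2 * ev i x q
    = i b0 + X + i b2 * X ^+ 2 + i b4 * X ^+ 4.
  have Y2 : Y ^+ 2 = A + (f1 ^+ 2 + f3 ^+ 2 * ev i x q) * w ^+ 2.
    by rewrite defY defA1 defB1 /A -w4; ring2 two0F.
  rewrite -eqX; transitivity ((Y ^+ 2) ^+ 2); last by ring.
  by rewrite Y2 -w4; ring2 two0F.
have [f30 [e [al [e0 def_f1 defX']]]] :=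
  denominator_constant nsq Rf1 Rf3 RA del0 Dx0 defX eqA.
rewrite f30 def_f1 in eqA.
pose S := poly0124 (b0 + e ^+ 4 * al + b2 * e ^+ 8 * al ^+ 2 + b4 * e ^+ 16 * al ^+ 4 + e ^+ 4 * a0)
  0 (b2 * e ^+ 8 + e ^+ 4 * a2) (b4 * e ^+ 16 + e ^+ 4 * a4).
have [s defA s2] : exists2 s, A = ev i x s & s ^+ 2 = S.
  apply: ratfun_sqrt => //.
  have -> : A ^+ 2 = i b0 + X + i b2 * X ^+ 2 + i b4 * X ^+ 4 + i e ^+ 4 * ev i x q.
    by rewrite -eqA; ring2 two0F.
  by rewrite !ev_poly0124 defX'; ring2 two0F.
have [def_s s02 s12 s22] := sqr_poly0124 two0 s2.
have [k [h [def_f0 def_f2 h2 k2]]] := ratfun_sqr_split x_tr two0 Rf0 Rf2 dq defA.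
have [t def_h t2] : exists2 t, h = t%:P & t ^+ 2 = s`_1.
  apply: sqr_polyC; rewrite h2 [in LHS]def_s !derivD derivC !deriv_mulC derivX derivXn.
  by rewrite -mulr_natr two0P; ring.
have k2' : k ^+ 2 = poly0124 (s`_0 + t ^+ 2 * a0) (s`_1 + t ^+ 2) (s`_2 + t ^+ 2 * a2) (t ^+ 2 * a4).
  by rewrite k2 def_h [X in X + _]def_s /poly0124; ring.
have [def_k k02 k12 k22] := sqr_poly0124 two0 k2'.
have t0 : t = 0.
  apply/eqP; apply: contraT => t0; case: nsq => [ns4|[a40 b40 ns2]].
    by case: ns4; exists (k`_2 / t); rewrite expr_div_n k22; field.
  have s20 : s`_2 = 0.
    by apply/eqP; rewrite -sqrf_eq0 s22 a40 b40 mul0r mulr0 addr0.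
  by case: ns2; exists (k`_1 / t); rewrite expr_div_n k12 s20; field.
have k20 : k`_2 = 0.
  by apply/eqP; rewrite -sqrf_eq0 k22 t0 expr0n mul0r.
rewrite t0 expr0n !mul0r !addr0 in k02 k12.
have b2E : e ^+ 4 * b2 = a2.
  apply: (mulfI (expf_neq0 4 e0)); apply: subr0_eq.
  have : s`_1 ^+ 2 = 0 by rewrite -t2 t0 !expr0n.
  rewrite s12 => E; transitivity (b2 * e ^+ 8 + e ^+ 4 * a2) => //; by ring2 two0.
have k14 : k`_1 ^+ 4 = b4 * e ^+ 16 + e ^+ 4 * a4.
  by rewrite -s22 -k12 -exprM.
have k04 : k`_0 ^+ 4 = b0 + e ^+ 4 * al + b2 * e ^+ 8 * al ^+ 2 + b4 * e ^+ 16 * al ^+ 4 + e ^+ 4 * a0.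
  by rewrite -s02 -k02 -exprM.
have ie0 : i e != 0 by rewrite fmorph_eq0.
have evk : ev i x k = i k`_0 + i k`_1 * x.
  by rewrite {1}def_k k20 mul0r addr0 rmorphD rmorphM /= !evC evX.
exists e, al, (k`_0 / e), (k`_1 / e); split=> //.
- rewrite defY defA1 defB1 f30 def_f1 def_f2 def_f0 evk def_h t0 evC.
  by rewrite !rmorph0 !fmorph_div; field.
- split=> //; rewrite expr_div_n k14; by field2 two0.
by rewrite !expr_div_n k14 k04 -b2E; field2 two0.
Qed.
End QuarticTransform.

(** * Function fields whose 2^n-th powers lie in K(x) *)

Section Transcendence.
Variables (K F : fieldType) (i : {rmorphism K -> F}).

Lemma algebraic_ev x p : algebraicOver i x -> algebraicOver i (ev i x p).
Proof.
move=> x_alg; elim/poly_ind: p => [|p c IHp].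
  by rewrite rmorph0 -(rmorph0 i); apply: algebraic_id.
rewrite rmorphD rmorphM /= evX evC.
by apply: algebraic_add; [apply: algebraic_mul | apply: algebraic_id].
Qed.

Lemma algebraic_root m u : (0 < m)%N -> algebraicOver i (u ^+ m) -> algebraicOver i u.
Proof.
move=> m_gt0 [p p0 /rootP pu]; exists (p \Po 'X^m).
  by rewrite comp_poly_eq0 // size_polyXn ltnS.
by apply/rootP; rewrite map_comp_poly map_polyXn horner_comp hornerXn.
Qed.

Lemma ratfun_power_total s x n : 2%:R = 0 :> F -> generated_by i s ->
  (forall u, u \in s -> ratfun i x (u ^+ (2 ^ n))) ->
  forall u, ratfun i x (u ^+ (2 ^ n)).
Proof.
move=> two0 gen pow_s; apply: (generated_ind gen) => //.
  exact/subfield_power/subfield_ratfun.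
by move=> a; rewrite -rmorphXn; apply: ratfun_const.
Qed.

(** If x were algebraic over K, so would be every element of K(x), hence every
    2^n-th power, hence all of F. *)
Lemma ratfun_power_transcendental x n : trdeg1 i ->
  (forall u, ratfun i x (u ^+ (2 ^ n))) -> ~ algebraicOver i x.
Proof.
case=> t [t_tr _] pow_u x_alg; apply: t_tr.
apply: (@algebraic_root (2 ^ n)); first by rewrite expn_gt0.
by case: (pow_u t) => p [d [_ ->]]; apply: algebraic_div; apply: algebraic_ev.
Qed.

(** u lies in the compositum of K and F^(2^n). *)
Definition frobenius_span n u := forall P : F -> Prop, subfield P ->
  (forall a, P (i a)) -> (forall v, P (v ^+ (2 ^ n))) -> P u.

Lemma subfield_adjoin s : subfield (in_adjoin i s).
Proof.
split=> [|u v Pu Pv|u v Pu Pv] S dS SK Ss.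
- by case: dS.
- by case: (dS) => _ SB _; apply: SB; [apply: Pu | apply: Pv].
- by case: (dS) => _ _ SV; apply: SV; [apply: Pu | apply: Pv].
Qed.

Lemma adjoin_const s a : in_adjoin i s (i a).
Proof. by move=> S _ SK _; apply: SK. Qed.

Lemma adjoin_gen s u : u \in s -> in_adjoin i s u.
Proof. by move=> su S _ _ Ss; apply: Ss. Qed.

Lemma generated_trans s r : generated_by i s ->
  (forall u, u \in s -> in_adjoin i r u) -> generated_by i r.
Proof.
by move=> gen sr u; apply: (generated_ind gen) => //; [apply: subfield_adjoin | apply: adjoin_const].
Qed.

End Transcendence.

Section Isomorphisms.
Variables (K F' F : fieldType) (i' : {rmorphism K -> F'}) (i : {rmorphism K -> F}).

Lemma ratfun_morph (phi : {rmorphism F' -> F}) x u : (forall a, phi (i' a) = i a) ->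
  ratfun i' x u -> ratfun i (phi x) (phi u).
Proof.
move=> phiK [p [d [d0 ->]]]; exists p, d.
have e r : ev i (phi x) r = phi (ev i' x r).
  rewrite /ev -horner_map -map_poly_comp; congr (_.[_]).
  by apply: eq_map_poly => a /=; rewrite phiK.
by rewrite !e fmorph_eq0 d0 fmorph_div.
Qed.

(** K(x) contains the 2^n-th powers and is contained in the compositum of K with
    them; both properties are transported by an isomorphism. *)
Lemma isom_ratfun n (phi : {rmorphism F' -> F}) x' x : K_isom i' i phi ->
  frobenius_span i' n x' -> frobenius_span i n x ->
  (forall u, ratfun i' x' (u ^+ (2 ^ n))) -> (forall u, ratfun i x (u ^+ (2 ^ n))) ->
  ratfun i x (phi x') /\ ratfun i (phi x') x.
Proof.
move=> [[psi _ psiK] phiK] span' span pow' pow; split.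
  apply: (span' (fun u => ratfun i x (phi u))).
  - have [R1 RB RV] := subfield_ratfun i x.
    split=> [|u v Pu Pv|u v Pu Pv]; first by rewrite rmorph1.
      by rewrite rmorphB; apply: RB.
    by rewrite fmorph_div; apply: RV.
  - by move=> a; rewrite phiK; apply: ratfun_const.
  - by move=> v; rewrite rmorphXn.
apply: span; first exact: subfield_ratfun.
  exact: ratfun_const.
by move=> v; rewrite -(psiK v) -rmorphXn; apply: ratfun_morph.
Qed.

Lemma K_isoms_given_byP (g : seq F') (T : seq F -> Prop) : generated_by i' g ->
  (forall phi : {rmorphism F' -> F}, K_isom i' i phi -> T (map phi g)) ->
  (forall h, T h -> exists phi : {rmorphism F' -> F}, K_isom i' i phi /\ map phi g = h) ->
  K_isoms_given_by i' i g T.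
Proof.
move=> gen fwd bwd; split=> // h /bwd[phi [iso_phi phi_g]]; exists phi; split=> //.
move=> psi [_ psiK] psi_g; have [_ phiK] := iso_phi.
apply: (generated_ind gen).
- split=> [|u v Pu Pv|u v Pu Pv]; first by rewrite !rmorph1.
    by rewrite !rmorphB Pu Pv.
  by rewrite !fmorph_div Pu Pv.
- by move=> a; rewrite psiK phiK.
by rewrite -phi_g in psi_g; apply/eq_in_map.
Qed.

End Isomorphisms.

(** The 2^n-th powers of u' and u are the same rational function p/d, taken at
    x' and at x. *)
Definition same_power (K F' F : fieldType) (i' : {rmorphism K -> F'}) (i : {rmorphism K -> F})
    n (x' : F') (x : F) (u' : F') (u : F) :=
  exists p d : {poly K}, [/\ d != 0, u' ^+ (2 ^ n) * ev i' x' d = ev i' x' p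
    & u ^+ (2 ^ n) * ev i x d = ev i x p].

Section SamePower.
Variables (K F' F : fieldType) (i' : {rmorphism K -> F'}) (i : {rmorphism K -> F}).
Variables (n : nat) (x' : F') (x : F).
Hypothesis two0 : 2%:R = 0 :> K.
Hypotheses (x'_tr : ~ algebraicOver i' x') (x_tr : ~ algebraicOver i x).
Local Notation G := (same_power i' i n x' x).
Let two0F : 2%:R = 0 :> F := two0_rmorph i two0.
Let two0F' : 2%:R = 0 :> F' := two0_rmorph i' two0.

Lemma ev_neq0 p : p != 0 -> ev i x p != 0.
Proof. by apply: contraNneq => /(ev_eq0 x_tr)->. Qed.

Lemma ev_neq0' p : p != 0 -> ev i' x' p != 0.
Proof. by apply: contraNneq => /(ev_eq0 x'_tr)->. Qed.

Lemma same_power_ev p u' u : u' ^+ (2 ^ n) = ev i' x' p -> u ^+ (2 ^ n) = ev i x p -> G u' u.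
Proof. by exists p, 1; rewrite !rmorph1 !mulr1 oner_neq0. Qed.

Lemma same_power_x : G x' x.
Proof. by apply: (@same_power_ev ('X ^+ (2 ^ n))); rewrite rmorphXn /= evX. Qed.

Lemma same_power_const a : G (i' a) (i a).
Proof. by apply: (@same_power_ev ((a ^+ (2 ^ n))%:P)); rewrite evC rmorphXn. Qed.

Lemma same_power_sub u' u v' v : G u' u -> G v' v -> G (u' - v') (u - v).
Proof.
move=> [p [d [d0 e1 e2]]] [q [e [e0 e3 e4]]].
exists (p * e - q * d), (d * e); rewrite mulf_neq0 // !exprB2n // !rmorphB !rmorphM /=.
by rewrite -e1 -e2 -e3 -e4; split=> //; ring.
Qed.

Lemma same_power_div u' u v' v : G u' u -> G v' v -> G (u' / v') (u / v).
Proof.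
move=> Gu [q [e [e0 e3 e4]]].
have m0 : (0 < 2 ^ n)%N by rewrite expn_gt0.
have [q0|q0] := eqVneq q 0.
  move: e3 e4; rewrite q0 !rmorph0 => /eqP e3 /eqP e4.
  move: e3 e4; rewrite !mulf_eq0 (negPf (ev_neq0 e0)) (negPf (ev_neq0' e0)) !orbF.
  rewrite !expf_eq0 m0 /= => /eqP-> /eqP->.
  by rewrite !invr0 !mulr0 -(rmorph0 i) -(rmorph0 i'); apply: same_power_const.
move: Gu => [p [d [d0 e1 e2]]].
exists (p * e), (d * q); rewrite mulf_neq0 // !expr_div_n !rmorphM /=.
have := ev_neq0 q0; have := ev_neq0' q0; rewrite -e3 -e4 -e1 -e2.
rewrite !mulf_eq0 !negb_or => /andP[v0' _] /andP[v0 _].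
by split=> //; field.
Qed.

Lemma same_power_inj u' u v : G u' u -> G u' v -> u = v.
Proof.
move=> [p [d [d0 e1 e2]]] [q [e [e0 e3 e4]]]; apply: (@expf2n_inj _ n _ _ two0F).
have pe : p * e = q * d by apply: (ev_inj x'_tr); rewrite !rmorphM /= -e1 -e3; ring.
apply: (mulIf (mulf_neq0 (ev_neq0 d0) (ev_neq0 e0))).
rewrite mulrA e2 mulrCA e4 -!rmorphM pe mulrC //.
Qed.

Lemma same_power_total (s' : seq F') : generated_by i' s' ->
  (forall u', u' \in s' -> exists u, G u' u) -> forall u', exists u, G u' u.
Proof.
move=> gen Gs; apply: (generated_ind gen).
- split; first by exists 1; rewrite -(rmorph1 i) -(rmorph1 i'); apply: same_power_const.
    by move=> u' v' [u Gu] [v Gv]; exists (u - v); apply: same_power_sub.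
  by move=> u' v' [u Gu] [v Gv]; exists (u / v); apply: same_power_div.
- by move=> a; exists (i a); apply: same_power_const.
- exact: Gs.
Qed.

End SamePower.

Lemma same_power_sym (K F' F : fieldType) (i' : {rmorphism K -> F'}) (i : {rmorphism K -> F}) n x' x u' u :
  same_power i' i n x' x u' u -> same_power i i' n x x' u u'.
Proof. by case=> p [d [d0 e1 e2]]; exists p, d. Qed.

(** The relation [same_power] is the graph of the isomorphism: it is a subfield
    of F' x F in the sense that it is closed under the field operations, it is
    functional in both directions because Frobenius is injective and x', x are
    transcendental, and it is total since it contains pairs above all
    generators. *)
Lemma same_power_isom (K F' F : fieldType) (i' : {rmorphism K -> F'}) (i : {rmorphism K -> F}) n x' x s' s :
  2%:R = 0 :> K -> ~ algebraicOver i' x' -> ~ algebraicOver i x ->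
  generated_by i' s' -> generated_by i s ->
  (forall u', u' \in s' -> exists u, same_power i' i n x' x u' u) ->
  (forall u, u \in s -> exists u', same_power i' i n x' x u' u) ->
  exists phi : {rmorphism F' -> F}, K_isom i' i phi /\
    forall u' u, same_power i' i n x' x u' u -> phi u' = u.
Proof.
move=> two0 x'_tr x_tr gen' gen Gs' Gs.
have tot := same_power_total two0 x'_tr x_tr gen' Gs'.
have tot' : forall u, exists u', same_power i i' n x x' u u'.
  apply: (same_power_total two0 x_tr x'_tr gen) => u /Gs[u' Gu].
  by exists u'; apply: same_power_sym.
have [f Gf] := choice tot; have [g Gg] := choice tot'.
have inj := same_power_inj (n := n) two0 x'_tr x_tr.
have inj' := same_power_inj (n := n) two0 x_tr x'_tr.
have fP u' u : same_power i' i n x' x u' u -> f u' = u by apply: inj.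
have fB : zmod_morphism f by move=> u v; apply: fP; apply: same_power_sub.
have fconst a : f (i' a) = i a by apply: fP; apply: same_power_const.
have fM : monoid_morphism f.
  have f1 : f 1 = 1 by rewrite -(rmorph1 i') fconst rmorph1.
  split=> // u v; apply: fP; rewrite -{1}[v]invrK -[f v]invrK.
  apply: same_power_div => //; rewrite -[v^-1]mul1r -[(f v)^-1]mul1r -f1.
  by apply: same_power_div.
pose phi : {rmorphism F' -> F} := HB.pack f
  (GRing.isZmodMorphism.Build F' F f fB) (GRing.isMonoidMorphism.Build F' F f fM).
exists phi; split=> //; split=> //; exists g => u.
- by apply: (inj' (f u)); [apply: Gg | apply: same_power_sym; apply: Gf].
- by apply: fP; apply: same_power_sym; apply: Gg.
Qed.

(** * Type (i) *)

(** The square of the equation expresses x^2 through fourth powers, and then the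
    equation does the same for x. *)
Lemma x_from_fourth_powers (K F : fieldType) (i : {rmorphism K -> F}) a0 a2 a4 x w :
  2%:R = 0 :> F ->
  w ^+ 4 = i a0 + x + i a2 * x ^+ 2 + i a4 * x ^+ 4 ->
  x = w ^+ 4 + i a0 + i a2 * ((w ^+ 4) ^+ 2 + i a0 ^+ 2
        + i a2 ^+ 2 * x ^+ 4 + i a4 ^+ 2 * (x ^+ 4) ^+ 2) + i a4 * x ^+ 4.
Proof. by move=> two0F ->; ring2 two0F. Qed.

Section TypeI.
Variable K : fieldType.
Hypothesis two0 : 2%:R = 0 :> K.
Variables (F : fieldType) (i : {rmorphism K -> F}) (a0 a2 a4 : K) (x y : F).
Hypothesis tF : type_i i a0 a2 a4 x y.
Let two0F : 2%:R = 0 :> F := two0_rmorph i two0.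

Lemma type_i_ev : y ^+ 4 = ev i x (poly0124 a0 1 a2 a4).
Proof. by case: tF => _ _ -> _; rewrite ev_poly0124 rmorph1 mul1r. Qed.

Lemma type_i_power u : ratfun i x (u ^+ (2 ^ 2)).
Proof.
case: tF => gen _ _ _; apply: (ratfun_power_total two0F gen) => v.
rewrite !inE => /orP[] /eqP->; last by rewrite type_i_ev; apply: ratfun_ev.
by rewrite -{2}(evX i x) -rmorphXn; apply: ratfun_ev.
Qed.

Lemma type_i_transcendental : ~ algebraicOver i x.
Proof. by case: tF => _ td _ _; apply: ratfun_power_transcendental td type_i_power. Qed.

Lemma type_i_span : frobenius_span i 2 x.
Proof.
case: tF => _ _ e _ P sP PK PF.
have [Px4 Py4] : P (x ^+ 4) /\ P (y ^+ 4) by split; apply: PF.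
rewrite (x_from_fourth_powers two0F e).
by do ?[exact: PK | exact: Px4 | exact: Py4 | apply: (subfieldD sP) | apply: (subfieldM sP) | apply: (subfieldX _ sP)].
Qed.

Lemma type_i_tower u : adjoin_sqrt (adjoin_sqrt (ratfun i x) (y ^+ 2)) y u.
Proof.
have sR := subfield_ratfun i x.
have s1 : subfield (adjoin_sqrt (ratfun i x) (y ^+ 2)).
  by apply: subfield_adjoin_sqrt => //; rewrite -exprM; apply: type_i_power.
have s2 : subfield (adjoin_sqrt (adjoin_sqrt (ratfun i x) (y ^+ 2)) y).
  by apply: subfield_adjoin_sqrt => //; apply: adjoin_sqrt_gen.
case: tF => gen _ _ _; apply: (generated_ind gen) => // [a|v].
  by do 2!apply: adjoin_sqrt_base => //; apply: ratfun_const.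
rewrite !inE => /orP[] /eqP->; last exact: adjoin_sqrt_gen.
by do 2!apply: adjoin_sqrt_base => //; apply: ratfun_x.
Qed.
End TypeI.

Lemma type_i_isom (K F F' : fieldType) (i : {rmorphism K -> F}) (i' : {rmorphism K -> F'})
    (a0 a2 a4 a0' a2' a4' : K) x y x' y' (phi : {rmorphism F' -> F}) :
  2%:R = 0 :> K -> type_i i a0 a2 a4 x y -> type_i i' a0' a2' a4' x' y' ->
  K_isom i' i phi ->
  exists e alpha beta gamma : K, [/\ phi x' = i (e ^+ 4) * (x + i alpha),
    phi y' = i e * (y + i gamma * x + i beta), e != 0,
    [/\ e ^+ 4 * a2' = a2 & e ^+ 12 * a4' = a4 + gamma ^+ 4]
    & e ^- 4 * a0' = a0 + alpha ^+ 2 * a2 + alpha ^+ 4 * a4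
        + beta ^+ 4 + gamma ^+ 4 * alpha ^+ 4 + alpha].
Proof.
move=> two0 tF tF' isoP.
have [RX Xx] := isom_ratfun isoP (type_i_span two0 tF') (type_i_span two0 tF)
  (type_i_power two0 tF') (type_i_power two0 tF).
apply: (quartic_transform two0 (type_i_transcendental two0 tF) (type_i_ev tF)) => //.
- by left; case: tF.
- exact: (type_i_tower two0 tF).
case: tF' => _ _ e _; rewrite -rmorphXn e !(rmorphD, rmorphM, rmorphXn).
by case: isoP => _ phiK; rewrite !phiK.
Qed.

Lemma pow4D2 (R : comPzRingType) (a b : R) :
  2%:R = 0 :> R -> (a + b) ^+ 4 = a ^+ 4 + b ^+ 4.
Proof. by move=> two0; rewrite -[4%N]/(2 * 2)%N !exprM !sqrD2. Qed.

(** The transformation is invertible over K, so X, Y generate F and X is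
    transcendental along with x. *)
Lemma type_i_change (K F : fieldType) (i : {rmorphism K -> F})
    (a0 a2 a4 a0' a2' a4' e alpha beta gamma : K) x y :
  2%:R = 0 :> K -> type_i i a0 a2 a4 x y ->
  e != 0 -> e ^+ 4 * a2' = a2 -> e ^+ 12 * a4' = a4 + gamma ^+ 4 ->
  e ^- 4 * a0' = a0 + alpha ^+ 2 * a2 + alpha ^+ 4 * a4
        + beta ^+ 4 + gamma ^+ 4 * alpha ^+ 4 + alpha ->
  let X := i (e ^+ 4) * (x + i alpha) in
  let Y := i e * (y + i gamma * x + i beta) in
  [/\ Y ^+ 4 = i a0' + X + i a2' * X ^+ 2 + i a4' * X ^+ 4,
      generated_by i [:: X; Y] & ~ algebraicOver i X].
Proof.
move=> two0 tF e0 h2 h4 h0 X Y; have two0F := two0_rmorph i two0.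
have ie0 : i e != 0 by rewrite fmorph_eq0.
have ie40 : i (e ^+ 4) != 0 by rewrite fmorph_eq0 expf_neq0.
have defx : x = X / i (e ^+ 4) - i alpha by rewrite /X; field.
split.
- rewrite /Y /X !exprMn !pow4D2 //; case: tF => _ _ -> _.
  have a2E := h2; have a4E : a4 = e ^+ 12 * a4' + gamma ^+ 4 by rewrite h4; ring2 two0.
  have a0E : a0' = e ^+ 4 * (a0 + alpha ^+ 2 * a2 + alpha ^+ 4 * a4
        + beta ^+ 4 + gamma ^+ 4 * alpha ^+ 4 + alpha).
    by rewrite -h0 mulVKf // expf_neq0.
  by rewrite a0E a4E -a2E !exprMn sqrD2 //; ring2 two0F.
- have sP := subfield_adjoin i [:: X; Y].
  have x_in : in_adjoin i [:: X; Y] x.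
    rewrite defx; apply: (subfieldB sP); last exact: adjoin_const.
    by apply: (subfield_div sP); [apply: adjoin_gen; rewrite inE eqxx | apply: adjoin_const].
  case: (tF) => gen _ _ _; apply: (generated_trans gen) => u.
  rewrite !inE => /orP[] /eqP-> //.
  have -> : y = Y / i e - i gamma * x - i beta by rewrite /Y; field.
  apply: (subfieldB sP); last exact: adjoin_const.
  apply: (subfieldB sP); last by apply: (subfieldM sP) => //; apply: adjoin_const.
  by apply: (subfield_div sP); [apply: adjoin_gen; rewrite !inE eqxx orbT | apply: adjoin_const].
move=> X_alg; apply: (type_i_transcendental two0 tF); rewrite defx.
by apply: algebraic_sub; [apply: algebraic_div => // |]; apply: algebraic_id.
Qed.

Lemma type_i_converse (K F F' : fieldType) (i : {rmorphism K -> F}) (i' : {rmorphism K -> F'})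
    (a0 a2 a4 : K) X Y x' y' :
  2%:R = 0 :> K -> type_i i' a0 a2 a4 x' y' ->
  Y ^+ 4 = i a0 + X + i a2 * X ^+ 2 + i a4 * X ^+ 4 ->
  generated_by i [:: X; Y] -> ~ algebraicOver i X ->
  exists phi : {rmorphism F' -> F}, K_isom i' i phi /\ map phi [:: x'; y'] = [:: X; Y].
Proof.
move=> two0 tF' eqY gen X_tr.
have Gx : same_power i' i 2 x' X x' X by apply: same_power_x.
have Gy : same_power i' i 2 x' X y' Y.
  apply: (same_power_ev (p := poly0124 a0 1 a2 a4)); first exact: type_i_ev tF'.
  by rewrite ev_poly0124 rmorph1 mul1r.
have gen' : generated_by i' [:: x'; y'] by case: tF'.
have [u'|u|phi [isoP phiG]] :=
  same_power_isom (n := 2) two0 (type_i_transcendental two0 tF') X_tr gen' gen.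
- by rewrite !inE => /orP[] /eqP->; [exists X | exists Y].
- by rewrite !inE => /orP[] /eqP->; [exists x' | exists y'].
by exists phi; rewrite /= (phiG _ _ Gx) (phiG _ _ Gy).
Qed.

(** * Type (ii) *)

(** The value of y^8 as a polynomial in x. *)
Definition octic (K : fieldType) (a0 a2 c0 c1 c2 : K) : {poly K} :=
  (c0 ^+ 4)%:P + (c1 ^+ 4)%:P * 'X^4 + poly0124 a0 1 a2 0
  + (c2 ^+ 4)%:P * poly0124 a0 1 a2 0 ^+ 2.

Lemma octic_relation (K F : fieldType) (i : {rmorphism K -> F}) a0 a2 c0 c1 c2 x z y :
  2%:R = 0 :> F ->
  z ^+ 4 = i a0 + x + i a2 * x ^+ 2 ->
  y ^+ 2 = i c0 + i c1 * x + z + i c2 * z ^+ 2 ->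
  y ^+ 8 = ev i x (octic a0 a2 c0 c1 c2).
Proof.
move=> two0F ez ey; have ezq : ev i x (poly0124 a0 1 a2 0) = z ^+ 4.
  by rewrite ev_poly0124 rmorph1 mul1r rmorph0 mul0r addr0 -ez.
rewrite /octic; move: (poly0124 _ _ _ _) ezq => q ezq.
rewrite !(rmorphD, rmorphXn, rmorphM) /= !evC evX ezq.
transitivity (((y ^+ 2) ^+ 2) ^+ 2); first by ring.
by rewrite ey !sqrD2 //; ring.
Qed.

Section TypeII.
Variable K : fieldType.
Hypothesis two0 : 2%:R = 0 :> K.
Variables (F : fieldType) (i : {rmorphism K -> F}) (a0 a2 c0 c1 c2 : K) (x z y : F).
Hypothesis tF : type_ii i a0 a2 c0 c1 c2 x z y.
Let two0F : 2%:R = 0 :> F := two0_rmorph i two0.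
Local Notation R := (ratfun i x).
Local Notation Kxz2 := (adjoin_sqrt R (z ^+ 2)).
Local Notation Kxz := (adjoin_sqrt Kxz2 z).
Let sR : subfield R := subfield_ratfun i x.

Lemma type_ii_ev : z ^+ 4 = ev i x (poly0124 a0 1 a2 0).
Proof.
by case: tF => _ -> _ _ _; rewrite ev_poly0124 rmorph1 mul1r rmorph0 mul0r addr0.
Qed.

Lemma type_ii_ev8 : z ^+ 8 = ev i x (poly0124 a0 1 a2 0 ^+ 2).
Proof. by rewrite rmorphXn /= -type_ii_ev -exprM. Qed.

Lemma type_ii_ev_y : y ^+ 8 = ev i x (octic a0 a2 c0 c1 c2).
Proof. by case: tF => _ ez ey _ _; apply: octic_relation ez ey. Qed.

Lemma type_ii_power u : ratfun i x (u ^+ (2 ^ 3)).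
Proof.
case: tF => -[gen _] _ _ _ _; apply: (ratfun_power_total two0F gen) => v.
rewrite !inE => /or3P[] /eqP->.
- by apply: subfieldX => //; apply: ratfun_x.
- by rewrite type_ii_ev8; apply: ratfun_ev.
- by rewrite type_ii_ev_y; apply: ratfun_ev.
Qed.

Lemma type_ii_transcendental : ~ algebraicOver i x.
Proof. by case: tF => -[_ td] _ _ _ _; apply: ratfun_power_transcendental td type_ii_power. Qed.

Lemma type_ii_span : frobenius_span i 3 x.
Proof.
case: tF => _ ez ey _ _ P sP PK PF.
have [Px8 [Pz8 Py8]] : P (x ^+ 8) /\ P (z ^+ 8) /\ P (y ^+ 8) by do !split; apply: PF.
have Px4 : P (x ^+ 4).
  have -> : x ^+ 4 = (z ^+ 8) ^+ 2 + i a0 ^+ 4 + i a2 ^+ 4 * x ^+ 8.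
    have -> : z ^+ 8 = (z ^+ 4) ^+ 2 by ring.
    by rewrite ez !sqrD2 //; ring2 two0F.
  by do ?[exact: PK | exact: Px8 | exact: Pz8 | apply: (subfieldD sP) | apply: (subfieldM sP) | apply: (subfieldX _ sP)].
have Px2 : P (x ^+ 2).
  have -> : x ^+ 2 = z ^+ 8 + i a0 ^+ 2 + i a2 ^+ 2 * x ^+ 4.
    have -> : z ^+ 8 = (z ^+ 4) ^+ 2 by ring.
    by rewrite ez !sqrD2 //; ring2 two0F.
  by do ?[exact: PK | exact: Px4 | exact: Pz8 | apply: (subfieldD sP) | apply: (subfieldM sP) | apply: (subfieldX _ sP)].
have -> : x = y ^+ 8 + i c0 ^+ 4 + i c1 ^+ 4 * x ^+ 4 + i c2 ^+ 4 * z ^+ 8 + i a0 + i a2 * x ^+ 2.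
  have -> : y ^+ 8 = ((y ^+ 2) ^+ 2) ^+ 2 by ring.
  have -> : z ^+ 8 = (z ^+ 4) ^+ 2 by ring.
  rewrite ey !sqrD2 //.
  transitivity (z ^+ 4 + i a0 + i a2 * x ^+ 2); last by ring2 two0F.
  by rewrite ez; ring2 two0F.
by do ?[exact: PK | exact: Px4 | exact: Px2 | exact: Pz8 | exact: Py8 | apply: (subfieldD sP) | apply: (subfieldM sP) | apply: (subfieldX _ sP)].
Qed.

Lemma subfield_Kxz2 : subfield Kxz2.
Proof.
apply: subfield_adjoin_sqrt => //; rewrite -exprM.
by rewrite type_ii_ev; apply: ratfun_ev.
Qed.

Lemma subfield_Kxz : subfield Kxz.
Proof. by apply: subfield_adjoin_sqrt => //; [apply: subfield_Kxz2 | apply: adjoin_sqrt_gen]. Qed.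

Lemma Kxz_ratfun u : R u -> Kxz u.
Proof. by move=> Ru; apply: adjoin_sqrt_base; [apply: subfield_Kxz2 | apply: adjoin_sqrt_base]. Qed.

Lemma Kxz_const a : Kxz (i a).
Proof. by apply: Kxz_ratfun; apply: ratfun_const. Qed.

Lemma Kxz_z : Kxz z.
Proof. exact/adjoin_sqrt_gen/subfield_Kxz2. Qed.

Lemma Kxz_y_sqr : Kxz (y ^+ 2).
Proof.
have sP := subfield_Kxz.
have S2x : Kxz x by apply: Kxz_ratfun; apply: ratfun_x.
case: tF => _ _ -> _ _.
by do ?[exact: Kxz_const | exact: S2x | exact: Kxz_z | apply: (subfieldD sP) | apply: (subfieldM sP) | apply: (subfieldX _ sP)].
Qed.

Lemma type_ii_sqr u : Kxz (u ^+ 2).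
Proof.
case: tF => -[gen _] _ _ _ _; apply: (generated_ind (P := fun u => Kxz (u ^+ 2)) gen).
- exact: (@subfield_power _ _ 1 two0F subfield_Kxz).
- by move=> a; rewrite -rmorphXn; apply: Kxz_const.
move=> v; rewrite !inE => /or3P[] /eqP->.
- by apply: Kxz_ratfun; apply: subfieldX => //; apply: ratfun_x.
- by apply: (subfieldX _ subfield_Kxz); apply: Kxz_z.
- exact: Kxz_y_sqr.
Qed.

Lemma type_ii_tower u : adjoin_sqrt Kxz y u.
Proof.
have sS2 := subfield_Kxz.
case: tF => -[gen _] _ _ _ _; apply: (generated_ind gen).
- by apply: subfield_adjoin_sqrt => //; apply: Kxz_y_sqr.
- by move=> a; apply: adjoin_sqrt_base => //; apply: Kxz_const.
move=> v; rewrite !inE => /or3P[] /eqP->; last exact: adjoin_sqrt_gen.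
  by apply: adjoin_sqrt_base => //; apply/Kxz_ratfun/ratfun_x.
by apply: adjoin_sqrt_base => //; apply: Kxz_z.
Qed.

(** The square of an element of K(x) that is a polynomial has derivative 0, while
    z^4 has derivative 1. *)
Lemma z_sqr_notin : ~ R (z ^+ 2).
Proof.
move=> Rz2; have [|h _ h2] := ratfun_sqrt (S := poly0124 a0 1 a2 0) type_ii_transcendental Rz2.
  by rewrite -exprM type_ii_ev.
have := congr1 (@deriv _) h2; rewrite deriv_poly0124 // deriv_sqr2 // => /eqP.
by rewrite eq_sym polyC_eq0 oner_eq0.
Qed.

(** If z = a + b z^2 then z^2 = a^2 + b^2 z^4 lies in K(x). *)
Lemma z_notin : ~ Kxz2 z.
Proof.
case=> a [b [Ra Rb e]]; apply: z_sqr_notin; rewrite e sqrD2 //.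
have -> : (b * z ^+ 2) ^+ 2 = b ^+ 2 * ev i x (poly0124 a0 1 a2 0) by rewrite -type_ii_ev; ring.
by apply: subfieldD => //; [apply: subfieldX | apply: subfieldM => //; [apply: subfieldX | apply: ratfun_ev]].
Qed.

(** The elements 1, z, z^2, z^3 are independent over K(x), and Y = g0 + g1 y with
    g0, g1 in K(x, z); so Y^2 = g0^2 + g1^2 y^2 can be compared coefficientwise.
    Each component of g0^2 or g1^2 has the form f^2 + g^2 q, and all but one of
    them turn out to be constants, which forces g = 0 and f constant.  The
    remaining one, A0, is linear in x: its g is a constant r, which vanishes
    because f^2 = A0 + r^2 q would otherwise make a2 a square. *)
Lemma type_ii_y_transform (c0' c1' c2' e alpha beta : K) X Z Y :
  e != 0 ->
  X = i (e ^+ 4) * (x + i alpha) -> Z = i e * (z + i beta) ->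
  Y ^+ 2 = i c0' + i c1' * X + Z + i c2' * Z ^+ 2 ->
  exists eps tau gamma : K, [/\ e = eps ^+ 2, Y = i eps * (y + i tau + i gamma * z),
    eps ^+ 6 * c1' = c1, eps ^+ 2 * c2' = c2 + gamma ^+ 2
    & eps ^- 2 * c0' = c0 + alpha * c1 + beta ^+ 2 * (c2 + gamma ^+ 2) + beta + tau ^+ 2].
Proof.
move=> e0 defX defZ eqY.
have x_tr := type_ii_transcendental.
pose q := poly0124 a0 1 a2 0; have z4 : z ^+ 4 = ev i x q := type_ii_ev.
have dq : q^`() = 1 := deriv_poly0124 two0 a0 1 a2 0.
have Rq : R (ev i x q) by apply: ratfun_ev.
have Rx : R x by apply: ratfun_x.
have RK a : R (i a) by apply: ratfun_const.
have two0P := two0_rmorph (@polyC K) two0.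
have [g0 [g1 [[u0 [u1 [[h0 [h2 [Rh0 Rh2 def_u0]]] [h1 [h3 [Rh1 Rh3 def_u1]]] def_g0]]]
             [v0 [v1 [[k0 [k2 [Rk0 Rk2 def_v0]]] [k1 [k3 [Rk1 Rk3 def_v1]]] def_g1]]] defY]]] :=
  type_ii_tower Y.
pose A0 := h0 ^+ 2 + h2 ^+ 2 * ev i x q; pose B0 := h1 ^+ 2 + h3 ^+ 2 * ev i x q.
pose A1 := k0 ^+ 2 + k2 ^+ 2 * ev i x q; pose B1 := k1 ^+ 2 + k3 ^+ 2 * ev i x q.
have g02 : g0 ^+ 2 = A0 + B0 * z ^+ 2.
  by rewrite def_g0 def_u0 def_u1 /A0 /B0 -z4; ring2 two0F.
have g12 : g1 ^+ 2 = A1 + B1 * z ^+ 2.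
  by rewrite def_g1 def_v0 def_v1 /A1 /B1 -z4; ring2 two0F.
pose L0 := A0 + A1 * (i c0 + i c1 * x) + B1 * i c2 * ev i x q.
pose L1 := B0 + B1 * (i c0 + i c1 * x) + A1 * i c2.
pose M0 := i c0' + i c1' * X + i e * i beta + i c2' * (i e * i beta) ^+ 2.
pose M1 := i c2' * i e ^+ 2.
have eqY' : (L0 + L1 * z ^+ 2) + (A1 + B1 * z ^+ 2) * z
  = (M0 + M1 * z ^+ 2) + (i e + 0 * z ^+ 2) * z.
  transitivity (Y ^+ 2); last by rewrite eqY defZ /M0 /M1; ring2 two0F.
  rewrite defY sqrD2 // exprMn g02 g12; case: tF => _ _ -> _ _.
  by rewrite /L0 /L1 -z4; ring.
have [RA0 RB0] : R A0 /\ R B0.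
  by split; do ?[assumption | apply: (subfieldD sR) | apply: (subfieldM sR) | apply: (subfieldX _ sR)].
have [RA1 RB1] : R A1 /\ R B1.
  by split; do ?[assumption | apply: (subfieldD sR) | apply: (subfieldM sR) | apply: (subfieldX _ sR)].
have RX : R X.
  by rewrite defX; do ?[apply: RK | assumption | apply: (subfieldD sR) | apply: (subfieldM sR) | apply: (subfieldX _ sR)].
have R0 : R 0 by apply: subfield0.
have S1I a b : R a -> R b -> Kxz2 (a + b * z ^+ 2) by move=> Ra Rb; exists a, b.
have RL0 : R L0.
  by do ?[apply: RK | assumption | apply: (subfieldD sR) | apply: (subfieldM sR) | apply: (subfieldX _ sR)].
have RL1 : R L1.
  by do ?[apply: RK | assumption | apply: (subfieldD sR) | apply: (subfieldM sR) | apply: (subfieldX _ sR)].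
have RM0 : R M0.
  by do ?[apply: RK | assumption | apply: (subfieldD sR) | apply: (subfieldM sR) | apply: (subfieldX _ sR)].
have RM1 : R M1.
  by do ?[apply: RK | assumption | apply: (subfieldD sR) | apply: (subfieldM sR) | apply: (subfieldX _ sR)].
have [eqKxz2 eqz] := adjoin_sqrt_uniq subfield_Kxz2 z_notin (S1I _ _ RL0 RL1) (S1I _ _ RA1 RB1)
  (S1I _ _ RM0 RM1) (S1I _ _ (RK e) R0) eqY'.
have [eqA1 eqB1] := adjoin_sqrt_uniq sR z_sqr_notin RA1 RB1 (RK e) R0 eqz.
have [eqA0 eqB0] := adjoin_sqrt_uniq sR z_sqr_notin RL0 RL1 RM0 RM1 eqKxz2.
rewrite /L0 /M0 eqA1 eqB1 in eqA0; rewrite /L1 /M1 eqA1 eqB1 in eqB0.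
have const_split f g c : R f -> R g -> f ^+ 2 + g ^+ 2 * ev i x q = i c ->
    g = 0 /\ exists2 t, f = i t & t ^+ 2 = c.
  move=> Rf Rg; rewrite -(evC i x) => efg.
  have [k [h [-> -> hh kk]]] := ratfun_sqr_split x_tr two0 Rf Rg dq efg.
  move: hh; rewrite derivC => /eqP; rewrite expf_eq0 => /eqP h0'.
  move: kk; rewrite h0' expr0n mul0r addr0 => /sqr_polyC[t -> t2].
  by rewrite rmorph0; split=> //; exists t; rewrite ?evC.
have [k20 [eps def_k0 eps2]] := const_split _ _ _ Rk0 Rk2 eqA1.
have [k30 [t def_k1 t2]] : k3 = 0 /\ exists2 t, k1 = i t & t ^+ 2 = 0.
  by apply: const_split => //; rewrite rmorph0.
have t0 : t = 0 by apply/eqP; rewrite -sqrf_eq0 t2.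
have [h30 [m def_h1 m2]] : h3 = 0 /\ exists2 m, h1 = i m & m ^+ 2 = c2' * e ^+ 2 + e * c2.
  apply: const_split => //; rewrite -/B0 !(rmorphD, rmorphXn, rmorphM) -eqB0.
  by ring2 two0F.
have eqA0' : A0 = ev i x ((c0' + c1' * e ^+ 4 * alpha + e * beta + c2' * (e * beta) ^+ 2 + e * c0)%:P
     + (c1' * e ^+ 4 + e * c1)%:P * 'X).
  transitivity (i c0' + i c1' * X + i e * i beta + i c2' * (i e * i beta) ^+ 2
      + i e * (i c0 + i c1 * x)); first by rewrite -eqA0; ring2 two0F.
  by rewrite rmorphD rmorphM /= !evC evX defX; ring.
have [k [h [def_h0 def_h2 hh kk]]] := ratfun_sqr_split x_tr two0 Rh0 Rh2 dq eqA0'.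
have [r def_h r2] : exists2 r, h = r%:P & r ^+ 2 = c1' * e ^+ 4 + e * c1.
  by apply: sqr_polyC; rewrite hh derivD derivC deriv_mulC derivX mulr1 add0r.
have kk' : k ^+ 2 = poly0124 (c0' + c1' * e ^+ 4 * alpha + e * beta + c2' * (e * beta) ^+ 2
       + e * c0 + r ^+ 2 * a0) (c1' * e ^+ 4 + e * c1 + r ^+ 2) (r ^+ 2 * a2) 0.
  by rewrite kk def_h /q /poly0124; ring.
have [def_k k02 k12 /eqP] := sqr_poly0124 two0 kk'.
rewrite sqrf_eq0 => /eqP k2_0.
have r0 : r = 0.
  apply/eqP; apply: contraT => r0; case: tF => _ _ _ ns2 _.
  by case: ns2; exists (k`_1 / r); rewrite expr_div_n k12; field.
have k1_0 : k`_1 = 0 by apply/eqP; rewrite -sqrf_eq0 k12 r0 expr0n mul0r.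
have evk : ev i x k = i k`_0 by rewrite def_k k1_0 k2_0 !mul0r !addr0 evC coefC.
have eps0 : eps != 0 by apply: contraNneq e0 => eps0; rewrite -eps2 eps0 expr0n.
have ieps0 : i eps != 0 by rewrite fmorph_eq0.
exists eps, (k`_0 / eps), (m / eps); split=> //.
- rewrite defY def_g0 def_g1 def_u0 def_u1 def_v0 def_v1 k20 k30 h30 def_k1 t0.
  rewrite def_h0 def_h2 def_h r0 evk evC def_h1 def_k0 !rmorph0 !fmorph_div.
  by field.
- have := r2; rewrite r0 expr0n /= -eps2 => E.
  apply: (mulfI (expf_neq0 2 eps0)); apply: subr0_eq.
  by rewrite [RHS]E; ring2 two0.
- by rewrite expr_div_n m2 -eps2; field2 two0.
rewrite !expr_div_n m2 k02 -eps2 r0.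
have -> : c1 = eps ^+ 6 * c1'.
  have := r2; rewrite r0 expr0n /= -eps2 => E.
  apply: (mulfI (expf_neq0 2 eps0)); apply: subr0_eq.
  by rewrite [RHS]E; ring2 two0.
by field2 two0.
Qed.
End TypeII.

(** The element z' is y'^2 up to terms in x' and z'^2, and squares of elements of F
    lie in K(x, z); so the image of z' lies in K(x, z), where the analysis of
    w^4 = q applies with w = z. *)
Lemma type_ii_isom (K F F' : fieldType) (i : {rmorphism K -> F}) (i' : {rmorphism K -> F'})
    (a0 a2 c0 c1 c2 a0' a2' c0' c1' c2' : K) x z y x' z' y' (phi : {rmorphism F' -> F}) :
  2%:R = 0 :> K -> type_ii i a0 a2 c0 c1 c2 x z y ->
  type_ii i' a0' a2' c0' c1' c2' x' z' y' -> K_isom i' i phi ->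
  exists eps alpha beta tau gamma : K,
    [/\ [/\ phi x' = i (eps ^+ 8) * (x + i alpha),
            phi z' = i (eps ^+ 2) * (z + i beta)
          & phi y' = i eps * (y + i tau + i gamma * z)],
        eps != 0,
        [/\ eps ^+ 8 * a2' = a2, eps ^+ 6 * c1' = c1
          & eps ^+ 2 * c2' = c2 + gamma ^+ 2],
        eps ^- 8 * a0' = a0 + alpha ^+ 2 * a2 + alpha + beta ^+ 4
      & eps ^- 2 * c0' = c0 + alpha * c1
          + beta ^+ 2 * (c2 + gamma ^+ 2) + beta + tau ^+ 2].
Proof.
move=> two0 tF tF' isoP; have [_ phiK] := isoP.
have two0F' := two0_rmorph i' two0.
have [RX Xx] := isom_ratfun isoP (type_ii_span two0 tF') (type_ii_span two0 tF)
  (type_ii_power two0 tF') (type_ii_power two0 tF).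
have [_ ez' ey' _ _] := tF'.
have eqZ : phi z' ^+ 4 = i a0' + phi x' + i a2' * phi x' ^+ 2 + i 0 * phi x' ^+ 4.
  by rewrite rmorph0 mul0r addr0 -rmorphXn ez' !(rmorphD, rmorphXn, rmorphM) /= !phiK.
have eqY : phi y' ^+ 2 = i c0' + i c1' * phi x' + phi z' + i c2' * phi z' ^+ 2.
  by rewrite -rmorphXn ey' !(rmorphD, rmorphXn, rmorphM) /= !phiK.
have KxzZ : adjoin_sqrt (adjoin_sqrt (ratfun i x) (z ^+ 2)) z (phi z').
  have sP := subfield_Kxz two0 tF.
  have -> : phi z' = phi y' ^+ 2 + i c0' + i c1' * phi x' + i c2' * phi z' ^+ 2.
    by rewrite eqY; ring2 (two0_rmorph i two0).
  have SK a := Kxz_const two0 tF a; have Ssqr u := type_ii_sqr two0 tF u.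
  have SX := Kxz_ratfun two0 tF RX.
  by do ?[apply: SK | apply: SX | apply: Ssqr | apply: (subfieldD sP) | apply: (subfieldM sP)].
have nsq : leading_nonsquare a2 0 0 by right; split=> //; case: tF.
have [e [alpha [beta [gamma [defX defZ e0 [ea2 ea4] ea0]]]]] :=
  quartic_transform two0 (type_ii_transcendental two0 tF) (type_ii_ev tF) nsq KxzZ RX Xx eqZ.
have gamma0 : gamma = 0.
  by apply/eqP; move/eqP: ea4; rewrite mulr0 add0r eq_sym expf_eq0.
rewrite gamma0 rmorph0 mul0r addr0 in defZ.
have [eps [tau [gamma' [def_e defY ec1 ec2 ec0]]]] :=
  type_ii_y_transform two0 tF e0 defX defZ eqY.
have pow k : e ^+ k = eps ^+ (2 * k) by rewrite def_e exprM.
exists eps, alpha, beta, tau, gamma'; split=> //.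
- by split=> //; [rewrite defX pow | rewrite defZ def_e].
- by apply: contraNneq e0 => eps0; rewrite def_e eps0 expr0n.
- by split=> //; rewrite -ea2 pow.
by rewrite pow in ea0; rewrite ea0 gamma0; ring.
Qed.

Lemma type_ii_change (K F : fieldType) (i : {rmorphism K -> F})
    (a0 a2 c0 c1 c2 a0' a2' c0' c1' c2' eps alpha beta tau gamma : K) x z y :
  2%:R = 0 :> K -> type_ii i a0 a2 c0 c1 c2 x z y ->
  eps != 0 -> eps ^+ 8 * a2' = a2 -> eps ^+ 6 * c1' = c1 ->
  eps ^+ 2 * c2' = c2 + gamma ^+ 2 ->
  eps ^- 8 * a0' = a0 + alpha ^+ 2 * a2 + alpha + beta ^+ 4 ->
  eps ^- 2 * c0' = c0 + alpha * c1
          + beta ^+ 2 * (c2 + gamma ^+ 2) + beta + tau ^+ 2 ->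
  let X := i (eps ^+ 8) * (x + i alpha) in
  let Z := i (eps ^+ 2) * (z + i beta) in
  let Y := i eps * (y + i tau + i gamma * z) in
  [/\ Z ^+ 4 = i a0' + X + i a2' * X ^+ 2,
      Y ^+ 2 = i c0' + i c1' * X + Z + i c2' * Z ^+ 2,
      generated_by i [:: X; Z; Y] & ~ algebraicOver i X].
Proof.
move=> two0 tF e0 h2 hc1 hc2 h0 hc0 X Z Y; have two0F := two0_rmorph i two0.
have ie0 : i eps != 0 by rewrite fmorph_eq0.
have ie80 : i (eps ^+ 8) != 0 by rewrite fmorph_eq0 expf_neq0.
have ie20 : i (eps ^+ 2) != 0 by rewrite fmorph_eq0 expf_neq0.
have defx : x = X / i (eps ^+ 8) - i alpha by rewrite /X; field.
have defz : z = Z / i (eps ^+ 2) - i beta by rewrite /Z; field.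
have a0E : a0' = eps ^+ 8 * (a0 + alpha ^+ 2 * a2 + alpha + beta ^+ 4).
  by rewrite -h0 mulVKf // expf_neq0.
have c0E : c0' = eps ^+ 2 * (c0 + alpha * c1
          + beta ^+ 2 * (c2 + gamma ^+ 2) + beta + tau ^+ 2).
  by rewrite -hc0 mulVKf // expf_neq0.
have c2E : c2 = eps ^+ 2 * c2' + gamma ^+ 2 by rewrite hc2; ring2 two0.
have [[gen _] ez ey _ _] := tF.
split.
- rewrite /Z /X !exprMn !pow4D2 // ez a0E -h2 sqrD2 //; ring2 two0F.
- rewrite /Y /Z /X !exprMn !sqrD2 // exprMn ey c0E c2E -hc1; ring2 two0F.
- have sP := subfield_adjoin i [:: X; Z; Y].
  have Kin a : in_adjoin i [:: X; Z; Y] (i a) by apply: adjoin_const.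
  have Xin : in_adjoin i [:: X; Z; Y] X by apply: adjoin_gen; rewrite !inE eqxx.
  have Zin : in_adjoin i [:: X; Z; Y] Z by apply: adjoin_gen; rewrite !inE eqxx orbT.
  have Yin : in_adjoin i [:: X; Z; Y] Y by apply: adjoin_gen; rewrite !inE eqxx !orbT.
  have zin : in_adjoin i [:: X; Z; Y] z.
    by rewrite defz; apply: (subfieldB sP) => //; apply: (subfield_div sP).
  apply: (generated_trans gen) => u; rewrite !inE => /or3P[] /eqP-> //.
    by rewrite defx; apply: (subfieldB sP) => //; apply: (subfield_div sP).
  have -> : y = Y / i eps - i gamma * z - i tau by rewrite /Y; field.
  apply: (subfieldB sP) => //; apply: (subfieldB sP); last exact: (subfieldM sP).
  exact: (subfield_div sP).
move=> X_alg; apply: (type_ii_transcendental two0 tF); rewrite defx.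
by apply: algebraic_sub; [apply: algebraic_div => // |]; apply: algebraic_id.
Qed.

Lemma type_ii_converse (K F F' : fieldType) (i : {rmorphism K -> F}) (i' : {rmorphism K -> F'})
    (a0 a2 c0 c1 c2 : K) X Z Y x' z' y' :
  2%:R = 0 :> K -> type_ii i' a0 a2 c0 c1 c2 x' z' y' ->
  Z ^+ 4 = i a0 + X + i a2 * X ^+ 2 ->
  Y ^+ 2 = i c0 + i c1 * X + Z + i c2 * Z ^+ 2 ->
  generated_by i [:: X; Z; Y] -> ~ algebraicOver i X ->
  exists phi : {rmorphism F' -> F},
    K_isom i' i phi /\ map phi [:: x'; z'; y'] = [:: X; Z; Y].
Proof.
move=> two0 tF' eqZ eqY gen X_tr; have two0F := two0_rmorph i two0.
have Gx : same_power i' i 3 x' X x' X by apply: same_power_x.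
have Gz : same_power i' i 3 x' X z' Z.
  apply: (same_power_ev (p := poly0124 a0 1 a2 0 ^+ 2)); first exact: type_ii_ev8 tF'.
  rewrite rmorphXn /= ev_poly0124 rmorph1 mul1r rmorph0 mul0r addr0 -eqZ.
  by ring.
have Gy : same_power i' i 3 x' X y' Y.
  apply: (same_power_ev (p := octic a0 a2 c0 c1 c2)); first exact (type_ii_ev_y two0 tF').
  exact: octic_relation two0F eqZ eqY.
have gen' : generated_by i' [:: x'; z'; y'] by case: tF' => -[].
have [u'|u|phi [isoP phiG]] :=
  same_power_isom (n := 3) two0 (type_ii_transcendental two0 tF') X_tr gen' gen.
- by rewrite !inE => /or3P[] /eqP->; [exists X | exists Z | exists Y].
- by rewrite !inE => /or3P[] /eqP->; [exists x' | exists z' | exists y'].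
by exists phi; rewrite /= (phiG _ _ Gx) (phiG _ _ Gz) (phiG _ _ Gy).
Qed.

(** * Isomorphisms and automorphisms *)

Lemma K_isoms_given_by_iff (K F' F : fieldType) (i' : {rmorphism K -> F'})
    (i : {rmorphism K -> F}) (g : seq F') (T T' : seq F -> Prop) :
  (forall h, T h <-> T' h) -> K_isoms_given_by i' i g T -> K_isoms_given_by i' i g T'.
Proof.
move=> TT' [fwd bwd]; split=> [phi /fwd/TT' //|h /TT'/bwd //].
Qed.

Lemma type_i_isoms (K F F' : fieldType) (i : {rmorphism K -> F}) (i' : {rmorphism K -> F'})
    (a0 a2 a4 a0' a2' a4' : K) (x y : F) (x' y' : F') :
  2%:R = 0 :> K -> type_i i a0 a2 a4 x y -> type_i i' a0' a2' a4' x' y' ->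
  K_isoms_given_by i' i [:: x'; y']
      (fun h => exists eps alpha beta gamma : K,
        [/\ h = [:: i (eps ^+ 4) * (x + i alpha);
                    i eps * (y + i gamma * x + i beta)],
            eps != 0,
            eps ^+ 4 * a2' = a2,
            eps ^+ 12 * a4' = a4 + gamma ^+ 4
          & eps ^- 4 * a0' = a0 + alpha ^+ 2 * a2 + alpha ^+ 4 * a4
              + beta ^+ 4 + gamma ^+ 4 * alpha ^+ 4 + alpha]).
Proof.
move=> two0 tF tF'; apply: K_isoms_given_byP; first by case: tF'.
  move=> phi isoP.
  have [e [al [be [ga [ex ey e0 [h2 h4] h0]]]]] := type_i_isom two0 tF tF' isoP.
  by exists e, al, be, ga; rewrite /= ex ey.
move=> h [e [al [be [ga [-> e0 h2 h4 h0]]]]].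
have [eqY gen X_tr] := type_i_change two0 tF e0 h2 h4 h0.
exact: type_i_converse two0 tF' eqY gen X_tr.
Qed.

Lemma type_ii_isoms (K F F' : fieldType) (i : {rmorphism K -> F}) (i' : {rmorphism K -> F'})
    (a0 a2 c0 c1 c2 a0' a2' c0' c1' c2' : K) (x z y : F) (x' z' y' : F') :
  2%:R = 0 :> K -> type_ii i a0 a2 c0 c1 c2 x z y ->
  type_ii i' a0' a2' c0' c1' c2' x' z' y' ->
  K_isoms_given_by i' i [:: x'; z'; y']
          (fun h => exists eps alpha beta tau gamma : K,
            [/\ h = [:: i (eps ^+ 8) * (x + i alpha);
                        i (eps ^+ 2) * (z + i beta);
                        i eps * (y + i tau + i gamma * z)],
                eps != 0,
                [/\ eps ^+ 8 * a2' = a2,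
                    eps ^+ 6 * c1' = c1
                  & eps ^+ 2 * c2' = c2 + gamma ^+ 2],
                eps ^- 8 * a0' = a0 + alpha ^+ 2 * a2 + alpha + beta ^+ 4
              & eps ^- 2 * c0' = c0 + alpha * c1
                  + beta ^+ 2 * (c2 + gamma ^+ 2) + beta + tau ^+ 2]).
Proof.
move=> two0 tF tF'; apply: K_isoms_given_byP; first by case: tF' => -[].
  move=> phi isoP.
  have [e [al [be [ta [ga [[ex ez ey] e0 h hz hy]]]]]] := type_ii_isom two0 tF tF' isoP.
  by exists e, al, be, ta, ga; rewrite /= ex ez ey.
move=> h [e [al [be [ta [ga [-> e0 [h2 hc1 hc2] h0 hc0]]]]]].
have [eqZ eqY gen X_tr] := type_ii_change two0 tF e0 h2 hc1 hc2 h0 hc0.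
exact: type_ii_converse two0 tF' eqZ eqY gen X_tr.
Qed.

Lemma expf2n_eq1 (K : fieldType) n (e : K) :
  2%:R = 0 :> K -> e ^+ (2 ^ n) = 1 -> e = 1.
Proof. by move=> two0 h; apply: (@expf2n_inj _ n _ _ two0); rewrite h expr1n. Qed.

Theorem proposition3p5 (K : fieldType) (charK : 2%N \in [pchar K]) :
  (* (i) *)
  (forall (F F' : fieldType)
      (i : {rmorphism K -> F}) (i' : {rmorphism K -> F'})
      (a0 a2 a4 a0' a2' a4' : K) (x y : F) (x' y' : F'),
    type_i i a0 a2 a4 x y -> type_i i' a0' a2' a4' x' y' ->
    K_isoms_given_by i' i [:: x'; y']
      (fun h => exists eps alpha beta gamma : K,
        [/\ h = [:: i (eps ^+ 4) * (x + i alpha);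
                    i eps * (y + i gamma * x + i beta)],
            eps != 0,
            eps ^+ 4 * a2' = a2,
            eps ^+ 12 * a4' = a4 + gamma ^+ 4
          & eps ^- 4 * a0' = a0 + alpha ^+ 2 * a2 + alpha ^+ 4 * a4
              + beta ^+ 4 + gamma ^+ 4 * alpha ^+ 4 + alpha]) /\
    K_isoms_given_by i i [:: x; y]
      (fun h => exists eps alpha beta : K,
        [/\ h = [:: i eps * (x + i alpha); i eps * (y + i beta)],
            eps ^+ 3 = 1,
            (eps + 1) * a2 = 0
          & beta ^+ 4 = (eps ^+ 2 + 1) * a0 + alpha ^+ 2 * a2
              + alpha ^+ 4 * a4 + alpha]))
  /\
  (* (ii) *)
  (forall (F F' : fieldType)
      (i : {rmorphism K -> F}) (i' : {rmorphism K -> F'})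
      (a0 a2 c0 c1 c2 a0' a2' c0' c1' c2' : K)
      (x z y : F) (x' z' y' : F'),
    type_ii i a0 a2 c0 c1 c2 x z y ->
    type_ii i' a0' a2' c0' c1' c2' x' z' y' ->
    [/\ K_isoms_given_by i' i [:: x'; z'; y']
          (fun h => exists eps alpha beta tau gamma : K,
            [/\ h = [:: i (eps ^+ 8) * (x + i alpha);
                        i (eps ^+ 2) * (z + i beta);
                        i eps * (y + i tau + i gamma * z)],
                eps != 0,
                [/\ eps ^+ 8 * a2' = a2,
                    eps ^+ 6 * c1' = c1
                  & eps ^+ 2 * c2' = c2 + gamma ^+ 2],
                eps ^- 8 * a0' = a0 + alpha ^+ 2 * a2 + alpha + beta ^+ 4
              & eps ^- 2 * c0' = c0 + alpha * c1
                  + beta ^+ 2 * (c2 + gamma ^+ 2) + beta + tau ^+ 2]),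
        (exists phi : {rmorphism F' -> F}, K_isom i' i phi) ->
          c1' ^+ 4 / a2' ^+ 3 = c1 ^+ 4 / a2 ^+ 3
      & K_isoms_given_by i i [:: x; z; y]
          (fun h => exists alpha beta tau : K,
            [/\ h = [:: x + i alpha; z + i beta; y + i tau],
                beta ^+ 4 = alpha + alpha ^+ 2 * a2
              & tau ^+ 2 = alpha * c1 + beta + beta ^+ 2 * c2])]).
Proof.
have two0 : 2%:R = 0 :> K by rewrite pcharf0.
split=> [F F' i i' a0 a2 a4 a0' a2' a4' x y x' y' tF tF'
        |F F' i i' a0 a2 c0 c1 c2 a0' a2' c0' c1' c2' x z y x' z' y' tF tF'].
- split; first exact: type_i_isoms.
  apply: K_isoms_given_by_iff (type_i_isoms two0 tF tF) => h; split.
    move=> [e [al [be [ga [-> e0 h2 h4 h0]]]]].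
    (* gamma^4 = (e^6 + 1)^2 a4 and a4 is not a square: e^6 = 1 and gamma = 0 *)
    have ga2 : (ga ^+ 2) ^+ 2 = (e ^+ 6 + 1) ^+ 2 * a4.
      transitivity (a4 + ga ^+ 4 - a4); first by ring.
      by rewrite -h4; ring2 two0.
    have e6 : e ^+ 6 = 1.
      apply: subr0_eq; apply/eqP; apply: contraT => e6.
      have e6' : e ^+ 6 + 1 != 0.
        by apply: contraNneq e6 => e6; apply/eqP; rewrite -e6; ring2 two0.
      case: tF => _ _ _ [].
      by exists (ga ^+ 2 / (e ^+ 6 + 1)); rewrite expr_div_n ga2; field.
    have ga0 : ga = 0.
      apply/eqP; move/eqP: ga2.
      have -> : e ^+ 6 + 1 = 0 by rewrite e6; ring2 two0.
      by rewrite expr0n mul0r !expf_eq0.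
    have e3 : e ^+ 3 = 1.
      by apply: (@expf2n_eq1 _ 1) => //; rewrite -exprM.
    have e4 : e ^+ 4 = e by rewrite exprS e3 mulr1.
    have eN4 : e ^- 4 = e ^+ 2.
      by apply: (mulfI (expf_neq0 4 e0)); rewrite mulfV ?expf_neq0 // -exprD e6.
    exists e, al, be; rewrite e4 ga0 rmorph0 mul0r addr0; split=> //.
      by rewrite mulrDl mul1r -{1}e4 h2; ring2 two0.
    rewrite eN4 ga0 in h0; apply: subr0_eq.
    transitivity (a0 + al ^+ 2 * a2 + al ^+ 4 * a4 + be ^+ 4 + 0 ^+ 4 * al ^+ 4 + al
      - e ^+ 2 * a0); last by rewrite -h0 subrr.
    by apply: subr0_eq; ring2 two0.
  move=> [e [al [be [-> e3 h2 h0]]]].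
  have e0 : e != 0 by apply: contraTneq (oner_neq0 K) => e0; rewrite -e3 e0 expr0n eqxx.
  have e4 : e ^+ 4 = e by rewrite exprS e3 mulr1.
  have e6 : e ^+ 6 = 1 by rewrite (exprM e 3 2) e3 expr1n.
  have eV : e^-1 = e ^+ 2 by apply: (mulfI e0); rewrite mulfV // -exprS e3.
  exists e, al, be, 0; rewrite e4 rmorph0 mul0r addr0; split=> //.
  + transitivity ((e + 1) * a2 + a2); last by rewrite h2 add0r.
    by ring2 two0.
  + by rewrite (exprM e 6 2) e6 expr1n mul1r expr0n addr0.
  by rewrite eV h0; ring2 two0.
have a2_neq0 : a2 != 0.
  by case: tF => _ _ _ ns _; apply: contra_notN ns => /eqP->; exists 0; rewrite expr0n.
split.
- exact: type_ii_isoms.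
- move=> [phi isoP].
  have [e [al [be [ta [ga [_ e0 [h2 h1 _] _ _]]]]]] := type_ii_isom two0 tF tF' isoP.
  rewrite -h2 -h1; rewrite -h2 mulf_eq0 negb_or in a2_neq0.
  by case/andP: a2_neq0 => _ a2'0; field; rewrite a2'0 e0.
apply: K_isoms_given_by_iff (type_ii_isoms two0 tF tF) => h; split.
  move=> [e [al [be [ta [ga [-> e0 [h2 h1 hc2] h0 hc0]]]]]].
  (* e^8 a2 = a2, and 1 has no other eighth root in characteristic 2 *)
  have e1 : e = 1.
    by apply: (@expf2n_eq1 _ 3) => //; apply: (mulIf a2_neq0); rewrite mul1r.
  rewrite e1 !expr1n !invr1 !mul1r in h2 h1 hc2 h0 hc0.
  have ga0 : ga = 0.
    by apply/eqP; rewrite -sqrf_eq0; apply/eqP/(addrI c2); rewrite -hc2 addr0.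
  exists al, be, ta; rewrite e1 ga0 !expr1n !rmorph1 rmorph0 !mul1r !mul0r addr0; split=> //.
    apply: (addrI (a0 + al ^+ 2 * a2 + al)); rewrite -h0; ring2 two0.
  rewrite ga0 in hc0.
  apply: (addrI (c0 + al * c1 + be ^+ 2 * (c2 + 0 ^+ 2) + be)); rewrite -hc0; ring2 two0.
move=> [al [be [ta [-> h0 hc0]]]].
exists 1, al, be, ta, 0.
rewrite !expr1n !rmorph1 rmorph0 !mul1r !mul0r addr0 invr1 !mul1r oner_neq0 expr0n addr0; split=> //.
  by rewrite h0; ring2 two0.
by rewrite hc0; ring2 two0.
Qed.
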